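(* Let $n\geq 2$ be an integer and let $2\leq\mu_1<\mu_2<\cdots$ be a strictly increasing sequence of integers. Suppose that for each $r$ we are given a finite $\mu_r$-sequence $(s(\mu_r)_0,\dots,s(\mu_r)_{n-1})$ such that the limit $$\tilde\Delta_{n-1}=\lim_{r\to\infty}\frac{\mu_r^{(n-1)/2}}{\sqrt{4^{n-1}\sum_{i=0}^{n-1}s(\mu_r)_i^2}}\,V_{n-1}$$ exists and is $>0$. Let $\sigma_n>0$ be a real number with $$2^{n-1}\tilde\Delta_{n-1}\sum_{k=1}^{A}\left(\sum_{l\mid k}\frac{\mu(l)}{l^{n-1}}\right)\left(1-k^2\left(2^{n-1}\tilde\Delta_{n-1}\frac{V_n}{V_{n-1}}\sigma_n\right)^2\right)^{(n-1)/2}<1,\qquad A=\left\lfloor\frac{2^{1-n}V_{n-1}}{V_n\tilde\Delta_{n-1}\sigma_n}\right\rfloor.$$ Then there exists an integer $R$ such that for all $r\geq R$ the $\mu_r$-sequence $(s(\mu_r)_0,\dots,s(\mu_r)_{n-1})$ can be extended to a $\mu_r$-sequence $(s(\mu_r)_0,\dots,s(\mu_r)_{n-1},s(\mu_r)_n)$ with $0<s(\mu_r)_n<\sigma_n\mu_r^{n/2}V_n$.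
   Context: For an integer $\mu\geq 2$, a $\mu$-sequence is a finite or infinite sequence $s_0=1,s_1,s_2,\dots$ of strictly positive integers such that for every $m\geq 1$ for which $s_m$ is defined, the $m$-dimensional lattice $\{(z_0,\dots,z_m)\in\mathbf{Z}^{m+1}:\sum_{k=0}^m s_kz_k=0\}$ has minimum (smallest squared Euclidean norm of a nonzero vector) at least $\mu$. $V_m=\pi^{m/2}/(m/2)!$ is the volume of the unit ball in $\mathbf{E}^m$ ($x!=\Gamma(x+1)$). $\mu(l)$ denotes the Möbius function and $\sum_{l\mid k}$ runs over positive divisors of $k$. *)

(* Defs.v *)
From HB Require Import structures.
From mathcomp Require Import all_boot all_order all_algebra.
From mathcomp Require Import all_classical all_reals all_analysis.

Set Implicit Arguments.
Unset Strict Implicit.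
Unset Printing Implicit Defensive.

Import Order.TTheory GRing.Theory Num.Theory.
Import numFieldNormedType.Exports.

Local Open Scope classical_set_scope.
Local Open Scope ring_scope.

Definition sqnorm (d : nat) (z : 'rV[int]_d) : int := \sum_(k < d) z 0 k ^+ 2.

(* The lattice of dimension m, inside Z^(m+1), orthogonal to (s_0, ..., s_m). *)
Definition orth_lattice (s : nat -> nat) (m : nat) : set 'rV[int]_m.+1 :=
  [set z | \sum_(k < m.+1) (s k)%:Z * z 0 k = 0].
Arguments orth_lattice s m : clear implicits.

Definition is_lattice_min (d : nat) (L : set 'rV[int]_d) (a : int) : Prop :=
  (exists z, [/\ L z, z != 0 & sqnorm z = a]) /\
  (forall z, L z -> z != 0 -> a <= sqnorm z).

(* Finite mu-sequences s_0, ..., s_N, stored as the list of their terms. The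
   condition s_0 = 1 excludes the empty list, since [nth] defaults to 0. *)
Definition mu_sequence (mu : nat) (s : seq nat) : Prop :=
  [/\ nth 0%N s 0 = 1%N,
      forall k, (k < size s)%N -> (0 < nth 0%N s k)%N
    & forall m, (0 < m < size s)%N ->
        exists2 a, is_lattice_min (orth_lattice (nth 0%N s) m) a & mu%:Z <= a].

(* Meaningful for l > 0; an l > 0 is squarefree when each of its prime factors
   has multiplicity 1. *)
Definition moebius (l : nat) : int :=
  if all (fun p => logn p l == 1%N) (primes l) then (-1) ^+ size (primes l)
  else 0.

(* Euler's integral, meaningful for x > 0. *)
Definition Gamma (R : realType) (x : R) : R :=
  Rintegral (@lebesgue_measure R) `]0, +oo[%classic
    (fun t => t `^ (x - 1) * expR (- t)).

(* The volume of the unit ball in Euclidean m-space, pi^(m/2) / (m/2)!. *)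
Definition ball_volume (R : realType) (m : nat) : R :=
  pi `^ (m%:R / 2) / Gamma (m%:R / 2 + 1).

(* Main.v *)
Require Import Defs.
From HB Require Import structures.
From mathcomp Require Import all_boot all_order all_algebra.
From mathcomp Require Import all_classical all_reals all_analysis.
From mathcomp Require Import measurable_realfun ring lra zify.

Set Implicit Arguments.
Unset Strict Implicit.
Unset Printing Implicit Defensive.

Import Order.TTheory GRing.Theory Num.Theory.
Import numFieldNormedType.Exports.

Local Open Scope classical_set_scope.
Local Open Scope ring_scope.

(** Write n = m + 1, rho = sqrt mu and let S be the Euclidean norm of
    (s_0, ..., s_m).  A value t spoils the extension exactly when some (z, k) with
    k > 0, gcd(z, k) = 1 and |z|^2 + k^2 < mu satisfies s.z = k t.  For t close to
    sigma mu^(n/2) V_n, the point z / rho of the unit ball then lies in a thin slab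
    orthogonal to s at height about k c, with c = 2^m Delta (V_n / V_m) sigma, which
    forces k <= A.  Since s_0 = 1, primitive z with k | s.z fill
    k^m sum_(l | k) moebius(l) / l^m residue classes mod k, and each class has about
    (rho / k)^n vol(slab) points.  The hypothesis on sigma says that these spoil
    fewer t than a short window below sigma mu^(n/2) V_n contains.

    The slab count must be uniform in the direction u = s / S.  Instead of measuring
    slabs, it uses the test functions exp(- p |x|^2 + q u.x): completing the square,
    their Riemann sums over boxes factor into one-dimensional Gaussian sums, and the
    limit depends on |u| = 1 only.  Products P(exp(- |x|^2)) Q(exp(u.x)) of explicit
    polynomial steps majorize the indicator of the slab tightly, and the Gamma
    function turns the radial factor into the volume of a ball. *)

(** * Riemann sums of the Gaussian *)

(** Only upper bounds on counts are needed, because t is found by contradiction: if every integer t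
    in [(1 - ze) T, T), with T = sigma mu^(n/2) V_n, were spoiled, each would carry its own witness,
    and the slabs would hold too many points. The window has to be short: then all heights k t / (S
    rho) are close to k c, which fixes both the range of k and the section (1 - (k c)^2)^(m/2) of
    the ball. Window length and slab thickness are both proportional to ze, so the strict inequality
    leaves a surplus of order ze rho^n; this is why the given quotient is compared with its limit
    Delta up to a relative error ze^2. The directions u need not converge as r grows, and the
    residue class mod k is arbitrary, so no constant of the counting may depend on u or on the shift
    of the grid. Exponentials provide this without a compactness argument: u and the shift only
    translate one-dimensional grids by bounded amounts, and the limit of a Gaussian sum does not see
    translations. *)

Lemma gauss_fun_lipschitz (R : realType) (x y : R) : x <= y ->
  `|gauss_fun y - gauss_fun x| <= y - x.
Proof.
move=> xy.
have dg (z : R) : is_derive z 1 (@gauss_fun R) (- (2 * z) * expR (- z ^+ 2)).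
  have h1 : is_derive z 1 (fun t : R => - t ^+ 2) (- (2 * z)).
    apply: is_derive_eq; rewrite /GRing.scale /=; ring.
  have h2 := is_derive_expR (- z ^+ 2).
  have := @is_derive1_comp _ expR (fun t : R => - t ^+ 2) z _ _ h2 h1.
  by rewrite mulrC.
have [c cxy ->] := @MVT_segment R _ _ x y xy (fun z _ => dg z)
  (continuous_subspaceT (@continuous_gauss_fun R)).
rewrite normrM [X in _ * X]ger0_norm ?subr_ge0 // ler_piMl ?subr_ge0 //.
rewrite normrM (ger0_norm (expR_ge0 _)) expRN ler_pdivrMr ?expR_gt0 // mul1r.
(* 2 |c| <= 1 + c^2 <= exp(c^2), the first because (|c| - 1)^2 >= 0. *)
apply: le_trans (expR_ge1Dx _).
rewrite normrN normrM ger0_norm // -(real_normK (num_real c)).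
have := sqr_ge0 (`|c| - 1); rewrite sqrrB !expr2; lra.
Qed.

Section gauss_primitive.
Variable R : realType.
Notation mu := (@lebesgue_measure R).

Definition gauss_cdf (x : R) := \int[mu]_(t in `]-oo, x]) gauss_fun t.

Lemma gauss_cdf_derive (x : R) : is_derive x 1 gauss_cdf (gauss_fun x).
Proof.
have [] := @continuous_FTC1 R (@gauss_fun R) -oo%O x (x + 1) _ _ _ _.
- by rewrite ltrDl.
- by apply: integrableS (@integrableT_gauss R) => //.
- by rewrite ltNyr.
- exact: continuous_gauss_fun.
by move=> dF F'; apply: (DeriveDef dF); rewrite -derive1E.
Qed.

Lemma gauss_cdf_mean_value (x y : R) : x <= y ->
  exists2 c, x <= c <= y & gauss_cdf y - gauss_cdf x = gauss_fun c * (y - x).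
Proof.
move=> xy.
have [|c] := @MVT_segment R gauss_cdf (@gauss_fun R) x y xy
  (fun z _ => gauss_cdf_derive z).
  by apply: derivable_within_continuous => z _; have [] := gauss_cdf_derive z.
by rewrite in_itv /= => cxy E; exists c.
Qed.

Lemma gauss_cdfB (x y : R) : x <= y ->
  gauss_cdf y - gauss_cdf x = \int[mu]_(t in `]x, y]) gauss_fun t.
Proof.
move=> xy; rewrite /gauss_cdf Rintegral_itvB //.
exact: integrableS (@integrableT_gauss R).
Qed.

Lemma gauss_mass_le (x y : R) : x <= y -> gauss_cdf y - gauss_cdf x <= Num.sqrt pi.
Proof.
move=> xy; rewrite gauss_cdfB // -lee_fin.
rewrite -(@integralT_gauss R) /Rintegral fineK; last first.
  apply: integrable_fin_num => //; exact: integrableS (@integrableT_gauss R).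
apply: ge0_subset_integral => //.
- by apply/measurable_realfun.measurable_EFinP; exact: measurable_gauss_fun.
- by move=> z _; rewrite lee_fin gauss_fun_ge0.
Qed.

Lemma gauss_mass_ge (e : R) : 0 < e -> exists2 B, 0 < B &
  forall x y, x <= - B -> B <= y -> Num.sqrt pi - e <= gauss_cdf y - gauss_cdf x.
Proof.
move=> e0.
pose F (n : nat) : set R := `]-n%:R, n%:R]%classic.
have H : (\int[mu]_(x in F i) (gauss_fun x)%:E @[i --> \oo] -->
    \int[mu]_(x in \bigcup_i F i) (gauss_fun x)%:E)%E.
  apply: ge0_nondecreasing_set_cvg_integral.
  - move=> i j ij; apply/subsetPset; apply: subset_itv; rewrite bnd_simp ?lerN2 ler_nat //.
  - by move=> i; exact: measurable_itv.
  - move=> i; apply/measurable_EFinP; apply: measurable_funTS.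
    exact: measurable_gauss_fun.
  - by move=> i x _; rewrite lee_fin gauss_fun_ge0.
move: H; rewrite (_ : \bigcup_i F i = setT); last first.
  apply/seteqP; split => // x _ /=; exists (Num.truncn `|x|).+1 => //.
  rewrite /F /= in_itv /=; have h := truncnS_gt `|x|.
  by move: (h); rewrite ltr_norml => /andP[-> /ltW ->].
rewrite integralT_gauss => /fine_cvgP[_ /cvgrPdist_le/(_ _ e0)[n _ Hn]].
have {Hn} /= := Hn n.+1 (leqnSn _).
rewrite -/(Rintegral mu _ _) => Hn.
exists n.+1%:R => // x y xn ny.
have mono a b : a <= b -> gauss_cdf a <= gauss_cdf b.
  move=> ab; rewrite -subr_ge0; have [c _ ->] := gauss_cdf_mean_value ab.
  by rewrite mulr_ge0 ?gauss_fun_ge0 ?subr_ge0.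
have n0 : - n.+1%:R <= n.+1%:R :> R by rewrite ge0_cp.
move: Hn; rewrite /F -gauss_cdfB // => Hn.
have := mono _ _ xn; have := mono _ _ ny.
move: Hn; rewrite ler_norml => /andP[_]; lra.
Qed.

(** An error h^2 per cell adds up to 2 M h^2 over a grid of 2M cells: this is the origin of the
    condition that M h^2 be small, which accompanies M h large throughout. *)
Lemma gauss_riemann_cell (x h : R) : 0 <= h ->
  `|h * gauss_fun x - (gauss_cdf (x + h) - gauss_cdf x)| <= h ^+ 2.
Proof.
move=> h0; have [|c /andP[xc cx] ->] := @gauss_cdf_mean_value x (x + h).
  by rewrite lerDl.
rewrite addrAC subrr add0r mulrC -mulrBl normrM (ger0_norm h0) expr2.
apply: ler_wpM2r => //; rewrite distrC (le_trans (gauss_fun_lipschitz xc)) //.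
by rewrite lerBlDl.
Qed.

Lemma gauss_riemann_partial (x h : R) (N : nat) : 0 <= h ->
  `|h * \sum_(j < N) gauss_fun (x + h * j%:R)
     - (gauss_cdf (x + h * N%:R) - gauss_cdf x)| <= N%:R * h ^+ 2.
Proof.
move=> h0; elim: N => [|N IH].
  by rewrite big_ord0 !mulr0 addr0 subrr subr0 normr0 mul0r.
rewrite big_ord_recr /= -natr1 !mulrDr mulr1 mulrDl mul1r.
have := gauss_riemann_cell (x + h * N%:R) h0; rewrite -addrA => H.
apply: le_trans (lerD IH H).
by apply: le_trans (ler_normD _ _); rewrite le_eqVlt; apply/orP; left;
  apply/eqP; congr `|_|; ring.
Qed.

Lemma shift_grid (c h a b : R) : c - h * a + h * b = h * (b - a) + c.
Proof. by ring. Qed.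

Lemma gauss_riemann1 (C e : R) : 0 < e -> exists B d : R, [/\ 0 < B, 0 < d &
  forall (h c : R) (M : nat), 0 < h -> `|c| <= C -> B <= M%:R * h ->
    M%:R * h ^+ 2 <= d ->
  `|h * (\sum_(j < M.*2) gauss_fun (h * (j%:R - M%:R) + c)) - Num.sqrt pi| <= e].
Proof.
move=> e0; have [B0 B00 HB] := gauss_mass_ge (divr_gt0 e0 (ltr0Sn _ 1)).
(* The 2M cells cost at most 2 d = e / 2 and the missing tails the other half; [|C|] absorbs the
   translation of the grid. *)
exists (B0 + `|C|), (e / 4); split; rewrite ?divr_gt0 // ?ltr_pwDl // => h c M h0 cC BM dM.
have CC := ler_norm C; move: cC; rewrite ler_norml => /andP[c1 c2].
have := gauss_riemann_partial (c - h * M%:R) M.*2 (ltW h0).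
under eq_bigr => j _ do rewrite (shift_grid c h M%:R j%:R).
rewrite (_ : c - h * M%:R + h * M.*2%:R = c + h * M%:R); last by rewrite -muln2 natrM; ring.
move=> H1.
have H2 : Num.sqrt pi - e / 2 <= gauss_cdf (c + h * M%:R) - gauss_cdf (c - h * M%:R).
  apply: HB; lra.
have H3 : gauss_cdf (c + h * M%:R) - gauss_cdf (c - h * M%:R) <= Num.sqrt pi.
  apply: gauss_mass_le; lra.
move: H1; rewrite -muln2 natrM !ler_norml => /andP[H4 H5]; apply/andP; split; lra.
Qed.

Lemma gauss_riemann (p C e : R) : 0 < p -> 0 < e -> exists B d : R, [/\ 0 < B, 0 < d &
  forall (h c : R) (M : nat), 0 < h -> `|c| <= C -> B <= M%:R * h ->
    M%:R * h ^+ 2 <= d ->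
  `|h * (\sum_(j < M.*2) expR (- (p * (h * (j%:R - M%:R) + c) ^+ 2)))
     - Num.sqrt (pi / p)| <= e].
Proof.
move=> p0 e0; have sp0 : 0 < Num.sqrt p by rewrite sqrtr_gt0.
have [B [d [B0 d0 H]]] := gauss_riemann1 (C * Num.sqrt p) (mulr_gt0 e0 sp0).
exists (B / Num.sqrt p), (d / p); split; rewrite ?divr_gt0 // => h c M h0 cC BM dM.
have := H (h * Num.sqrt p) (c * Num.sqrt p) M.
rewrite mulr_gt0 // normrM (ger0_norm (ltW sp0)) ler_pM2r //.
rewrite mulrA exprMn mulrA sqr_sqrtr ?(ltW p0) //.
move: BM dM; rewrite ler_pdivrMr // ler_pdivlMr // => BM dM.
move=> /(_ isT cC BM dM) {cC BM dM}.
under eq_bigr => j _.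
  rewrite /gauss_fun (_ : _ ^+ 2 = p * (h * (j%:R - M%:R) + c) ^+ 2); last first.
    rewrite -[in RHS](sqr_sqrtr (ltW p0)); ring.
  over.
rewrite sqrtrM ?pi_ge0 // sqrtrV ?(ltW p0) //.
have -> : forall S : R, h * Num.sqrt p * S - Num.sqrt pi =
    (h * S - Num.sqrt pi / Num.sqrt p) * Num.sqrt p.
  by move=> S; rewrite mulrBl divfK ?gt_eqF // mulrAC.
by rewrite normrM (ger0_norm (ltW sp0)) ler_pM2r.
Qed.
End gauss_primitive.

(** * The Gamma integral and ball volumes *)

Section gamma.
Variable R : realType.
Notation mu := (@lebesgue_measure R).

Lemma expR_decay_continuous (p : R) : continuous (fun t : R => expR (- (p * t))).
Proof.
move=> x; apply: continuous_comp; last exact: continuous_expR.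
by apply: continuousN; apply: mulrl_continuous.
Qed.

Lemma sqrt_exp_continuous (m : nat) (p : R) :
  continuous (fun t : R => Num.sqrt t ^+ m * (p * expR (- (p * t)))).
Proof.
move=> x; apply: cvgM.
  apply: (@continuous_comp _ _ _ (@Num.sqrt R) (fun t => t ^+ m)); first exact: sqrt_continuous.
  exact: exprn_continuous.
apply: cvgM; first exact: cvg_cst.
exact: expR_decay_continuous.
Qed.

Lemma integral_exp_decay (p : R) : 0 < p ->
  (\int[mu]_(t in `]0%R, +oo[) (p * expR (- (p * t)))%:E = 1)%E.
Proof.
move=> p0; have c : continuous (fun t : R => p * expR (- (p * t))).
  move=> x; apply: cvgM; first exact: cvg_cst.
  exact: expR_decay_continuous.
rewrite integral_itv_obnd_cbnd; last first.
  by apply/measurable_EFinP; apply: measurable_funTS; exact: continuous_measurable_fun.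
have d (x : R) : is_derive x 1 (fun t : R => - expR (- (p * t))) (p * expR (- (p * x))).
  have h1 : is_derive x 1 (fun t : R => - (p * t)) (- p).
    by apply: is_derive_eq; rewrite /GRing.scale /= ?mulr1.
  have h2 := @is_derive1_comp _ expR _ x _ _ (is_derive_expR (- (p * x))) h1.
  have := is_deriveN h2; rewrite mulrN opprK mulrC; exact.
rewrite (@ge0_continuous_FTC2y _ _ (fun t : R => - expR (- (p * t))) 0 0).
- by rewrite mulr0 oppr0 expR0 EFinN oppeK add0e.
- by move=> x _; rewrite mulr_ge0 ?expR_ge0 ?ltW.
- exact: continuous_subspaceT.
- rewrite -oppr0; apply: cvgN.
  apply: (@cvg_comp _ _ _ (fun t : R => p * t) (fun z => expR (- z)) _ (pinfty_nbhs R));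
    last exact: cvgr_expR.
  exact: gt0_cvgMry.
- by move=> x _; have [] := d x.
- by apply: cvg_at_right_filter; apply: cvgN; exact: expR_decay_continuous.
- by move=> x _; rewrite derive1E; have [] := d x.
Qed.

Lemma sqrt_exp_integrable (m : nat) (p : R) : 0 < p ->
  mu.-integrable `]0, +oo[ (EFin \o (fun t : R => Num.sqrt t ^+ m * (p * expR (- (p * t))))).
Proof.
move=> p0.
have int0 (q : R) : 0 < q -> mu.-integrable `]0, +oo[ (EFin \o (fun t => q * expR (- (q * t)))).
  move=> q0; apply/integrableP; split.
    apply/measurable_EFinP; apply: measurable_funTS; apply: continuous_measurable_fun.
    move=> x; apply: cvgM; first exact: cvg_cst.
    exact: expR_decay_continuous.
  under eq_integral do rewrite /= ger0_norm ?mulr_ge0 ?expR_ge0 ?(ltW q0) //.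
  by rewrite integral_exp_decay // ltry.
have [-> |m0] := eqVneq m 0%N.
  by under [X in EFin \o X]eq_fun do rewrite expr0 mul1r; exact: int0.
have p20 : 0 < p / 2 by rewrite divr_gt0.
(* Since sqrt t <= 1 + t <= (1 + 2m/p) (1 + p t / (2m)) and (1 + x/m)^m <= exp x at x = p t / 2,
   half of the decay pays for the power of t. The factor 2 compensates the density p / 2 of the
   dominating function. *)
pose K : R := 2 * (1 + (2 * m%:R) / p) ^+ m.
apply: (@le_integrable _ _ _ mu _ _ _ (EFin \o (fun t =>
  K * (p / 2 * expR (- (p / 2 * t)))))) => //.
- by apply/measurable_EFinP; apply: measurable_funTS; apply: continuous_measurable_fun;
    exact: sqrt_exp_continuous.
- move=> t /=; rewrite in_itv /= andbT => t0.
  rewrite lee_fin !ger0_norm; last 2 first.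
  + rewrite !mulr_ge0 ?expR_ge0 ?exprn_ge0 ?addr_ge0 ?mulr_ge0 ?invr_ge0 ?(ltW p0) //.
  + rewrite !mulr_ge0 ?expR_ge0 ?exprn_ge0 ?sqrtr_ge0 ?(ltW p0) //.
  have m1 : 1 <= m%:R :> R by rewrite ler1n lt0n.
  have q0 : 0 <= 2 * m%:R / p by rewrite divr_ge0 ?mulr_ge0 ?ler0n // ltW.
  have s1 : Num.sqrt t <= (1 + 2 * m%:R / p) * (1 + p / (2 * m%:R) * t).
    have : Num.sqrt t <= 1 + t.
      rewrite -(ler_pXn2r (n:=2)) ?nnegrE ?sqrtr_ge0 ?addr_ge0 ?(ltW t0) //.
      by rewrite sqr_sqrtr ?(ltW t0) // sqrrD expr1n mul1r; have := sqr_ge0 t; lra.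
    move/le_trans; apply; rewrite mulrDl mul1r mulrDr mulr1.
    rewrite mulrA (_ : 2 * m%:R / p * (p / (2 * m%:R)) = 1); last by field;
      rewrite ?gt_eqF // (lt_le_trans ltr01).
    have : 0 <= p / (2 * m%:R) * t by rewrite !mulr_ge0 ?invr_ge0 ?mulr_ge0 ?(ltW p0) ?(ltW t0).
    by lra.
  have s2 : Num.sqrt t ^+ m <= (1 + 2 * m%:R / p) ^+ m * expR (p / 2 * t).
    apply: (@le_trans _ _ (((1 + 2 * m%:R / p) * (1 + p / (2 * m%:R) * t)) ^+ m)).
      by rewrite lerXn2r ?nnegrE ?sqrtr_ge0 // (le_trans (sqrtr_ge0 t)).
    rewrite exprMn ler_wpM2l ?exprn_ge0 ?addr_ge0 //.
    rewrite (_ : p / 2 * t = p / (2 * m%:R) * t * m%:R); last by field;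
      rewrite ?gt_eqF // (lt_le_trans ltr01).
    rewrite expRM_natr lerXn2r ?nnegrE ?expR_ge0 ?expR_ge1Dx //.
    by rewrite addr_ge0 // !mulr_ge0 ?invr_ge0 ?mulr_ge0 ?(ltW p0) ?(ltW t0).
  rewrite (_ : - (p * t) = - (p / 2 * t) - p / 2 * t); last by field.
  rewrite expRD (expRN (p / 2 * t)) /K.
  apply: le_trans (ler_wpM2r _ s2) _; first by rewrite !mulr_ge0 ?invr_ge0 ?expR_ge0 ?(ltW p0).
  rewrite le_eqVlt; apply/orP; left; apply/eqP; field.
  by rewrite !gt_eqF ?expR_gt0.
- exact: (integrableZl _ K (int0 _ p20)).
Qed.

Definition sqrt_exp_int (m : nat) (p : R) : R :=
  \int[mu]_(t in `]0%R, +oo[) (Num.sqrt t ^+ m * (p * expR (- (p * t)))).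

Lemma Gamma_half (m : nat) : Gamma (m%:R / 2 + 1) = sqrt_exp_int m 1.
Proof.
apply: eq_Rintegral => t; rewrite inE /= in_itv /= andbT => t0.
rewrite addrK !mul1r; congr (_ * _).
by rewrite mulrC powRrM powR_mulrn ?powR_ge0 // powR12_sqrt ?ltW.
Qed.

Lemma sqrt_exp_int_gt0 (m : nat) (p : R) : 0 < p -> 0 < sqrt_exp_int m p.
Proof.
move=> p0.
have I := sqrt_exp_integrable m p0.
rewrite -lte_fin /sqrt_exp_int /Rintegral fineK; last exact: integrable_fin_num.
pose f := EFin \o (fun t : R => Num.sqrt t ^+ m * (p * expR (- (p * t)))).
have pe : 0 < p * expR (- (p * 2)) by rewrite mulr_gt0 ?expR_gt0.
apply: (@lt_le_trans _ _ (\int[mu]_(t in `[1%R, 2%R]) (p * expR (- (p * 2)))%:E)%E).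
  rewrite integral_cst //= lebesgue_measure_itv /= lte_fin ltr1n /= -EFinD -EFinM lte_fin.
  by rewrite mulr_gt0 // subr_gt0 ltr1n.
apply: (@le_trans _ _ (\int[mu]_(t in `[1%R, 2%R]) f t)%E).
  apply: ge0_le_integral => //.
  - by move=> t _; rewrite lee_fin ltW.
  - apply/measurable_EFinP; apply: measurable_funTS; apply: continuous_measurable_fun.
    exact: sqrt_exp_continuous.
  - move=> t; rewrite /= in_itv /= => /andP[t1 t2]; rewrite lee_fin.
    rewrite -[leLHS]mul1r ler_pM ?(ltW pe) //; last first.
      by rewrite ler_pM2l // ler_expR lerN2 ler_pM2l.
    by apply: exprn_ege1; rewrite -[leLHS]sqrtr1 ler_wsqrtr.
apply: ge0_subset_integral => //.
- apply/measurable_EFinP; apply: measurable_funTS; apply: continuous_measurable_fun.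
  exact: sqrt_exp_continuous.
- by move=> t _; rewrite lee_fin !mulr_ge0 ?exprn_ge0 ?sqrtr_ge0 ?expR_ge0 ?(ltW p0).
- by apply: subset_itv; rewrite bnd_simp.
Qed.

Lemma sqrt_exp_scaling (m : nat) (p : R) : 0 < p ->
  sqrt_exp_int m p = sqrt_exp_int m 1 / Num.sqrt p ^+ m.
Proof.
move=> p0.
pose G (t : R) := Num.sqrt t ^+ m * (1 * expR (- (1 * t))).
have dF (x : R) : is_derive x 1 (fun t : R => p * t) p.
  by apply: is_derive_eq; rewrite /GRing.scale /= ?mulr1.
have dF1 : derive1 (fun t : R => p * t) = fun=> p.
  by apply/funext => x; rewrite derive1E; have [] := dF x.
have cG : continuous G := @sqrt_exp_continuous m 1.
have G0 t : 0 <= G t by rewrite !mulr_ge0 ?exprn_ge0 ?sqrtr_ge0 ?expR_ge0.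
have H : (\int[mu]_(x in `[0%R, +oo[) (G x)%:E =
   \int[mu]_(x in `[0%R, +oo[) (((G \o (fun t : R => p * t)%R) * (cst p))%R x)%:E)%E.
  rewrite (_ : cst p = derive1 (fun t : R => p * t)); last by rewrite dF1.
  rewrite -[in LHS](mulr0 p).
  apply: increasing_ge0_integration_by_substitutiony; rewrite ?dF1.
  - by move=> x y _ _ xy; rewrite ltr_pM2l.
  - by move=> x _; exact: cvg_cst.
  - exact: is_cvg_cst.
  - exact: is_cvg_cst.
  - split; first by move=> x _; have [] := dF x.
    by apply: cvg_at_right_filter; exact: mulrl_continuous.
  - exact: gt0_cvgMry.
  - exact: continuous_subspaceT.
  - by move=> x _; exact: G0.
have mG : measurable_fun setT G := continuous_measurable_fun cG.
have mGp : measurable_fun setT ((G \o (fun t : R => p * t)%R) * (cst p)).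
  apply: continuous_measurable_fun => x; apply: cvgM; last exact: cvg_cst.
  by apply: continuous_comp; [exact: mulrl_continuous|exact: cG].
have sp : 0 < Num.sqrt p ^+ m by rewrite exprn_gt0 // sqrtr_gt0.
have -> : sqrt_exp_int m 1 = fine (\int[mu]_(x in `[0%R, +oo[) (G x)%:E)%E.
  rewrite /sqrt_exp_int /Rintegral integral_itv_obnd_cbnd //.
  by apply/measurable_EFinP; apply: measurable_funTS.
rewrite H -integral_itv_obnd_cbnd; last first.
  by apply/measurable_EFinP; apply: measurable_funTS.
rewrite -/(Rintegral mu _ _).
rewrite (@eq_Rintegral _ _ _ mu _
  (fun t => Num.sqrt p ^+ m * (Num.sqrt t ^+ m * (p * expR (- (p * t)))))).
  by rewrite RintegralZl //; [rewrite mulrAC divff ?gt_eqF // mul1r|exact: sqrt_exp_integrable].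
have E (t : R) : G (p * t) * p = Num.sqrt p ^+ m * (Num.sqrt t ^+ m * (p * expR (- (p * t)))).
  by rewrite /G sqrtrM ?(ltW p0) // exprMn !mul1r; ring.
by move=> t _; exact: E.
Qed.


(** Layer-cake formula: exp(- p |x|^2) averages the indicators of the balls |x|^2 <= t with density
    p exp(- p t), so the Gaussian integral over m-space is V_m times the moment of t^(m/2). No
    integral over m-space is taken: p = 1 is the formula defining V_m, and the general case follows
    by scaling. *)
Lemma gauss_gamma (m : nat) (p : R) : 0 < p ->
  Num.sqrt (pi / p) ^+ m = ball_volume R m *
sqrt_exp_int m p.
Proof.
move=> p0; rewrite sqrt_exp_scaling // /ball_volume Gamma_half.
rewrite (mulrC m%:R) powRrM powR_mulrn ?powR_ge0 // powR12_sqrt ?pi_ge0 //.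
rewrite sqrtrM ?pi_ge0 // sqrtrV ?(ltW p0) // expr_div_n.
by field; rewrite !gt_eqF ?(sqrt_exp_int_gt0 m ltr01) ?exprn_gt0 ?sqrtr_gt0.
Qed.

Lemma ball_volume_gt0 (m : nat) : 0 < ball_volume R m.
Proof.
by rewrite /ball_volume Gamma_half divr_gt0 ?(sqrt_exp_int_gt0 m ltr01) ?powR_gt0 ?pi_gt0.
Qed.
End gamma.

(** * Polynomials approximating steps *)

Section step_poly.
Variable R : realType.
Implicit Types (w y e : R) (a N : nat).
Notation mu := (@lebesgue_measure R).

(** The steps of elementary proofs of the Stone-Weierstrass theorem: on [0, 1] the value passes from
    near 0 to near 1 around x^a = 1/N. For a > 0 the constant term vanishes. *)
Definition step_poly (a N : nat) : {poly R} := 1 - (1 - 'X^a) ^+ N.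

Lemma horner_step_poly a N w :
  (step_poly a N).[w] = 1 - (1 - w ^+ a) ^+ N.
Proof. by rewrite /step_poly !hornerE. Qed.

Lemma expRN_unit w : 0 <= w -> 0 <= expR (- w) <= 1.
Proof. by move=> w0; rewrite expR_ge0 -expR0 ler_expR oppr_le0. Qed.

Lemma step_poly_ge0_le1 a N (x : R) : 0 <= x <= 1 -> 0 <= (step_poly a N).[x] <= 1.
Proof.
move=> /andP[x0 x1]; rewrite horner_step_poly.
have h : 0 <= 1 - x ^+ a <= 1 by rewrite subr_ge0 exprn_ile1 //= lerBlDr lerDl exprn_ge0.
case/andP: h => h0 h1.
by rewrite subr_ge0 exprn_ile1 //= lerBlDr lerDl exprn_ge0.
Qed.

Lemma bernoulli_onem (x : R) N : 0 <= x <= 1 -> 1 - (1 - x) ^+ N <= N%:R * x.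
Proof.
move=> /andP[x0 x1]; elim: N => [|N IH]; first by rewrite expr0 subrr mul0r.
rewrite exprS mulrDl mul1r mulNr -natr1 mulrDl mul1r.
have : (1 - x) ^+ N <= 1 by rewrite exprn_ile1 ?subr_ge0 // lerBlDr lerDl.
have : 0 <= (1 - x) ^+ N by rewrite exprn_ge0 ?subr_ge0.
nra.
Qed.

(** With t the midpoint of th and th', k half their distance, and N about exp(a t), the product N
    exp(- w)^a is about exp(a (t - w)): at least exp(a k) before th, at most 2 exp(- a k) after th'.
    The last clause bounds x P'(x) at x = exp(- w); the factor exp(- w) on its right keeps it
    integrable against powers of w. *)
Lemma exists_step_poly (th th' e : R) : 0 < th -> th < th' -> 0 < e ->
  exists a N, [/\ (0 < a)%N, (0 < N)%N,
    forall w, 0 <= w -> w <= th -> 1 - e <= (step_poly a N).[expR (- w)],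
    forall w, th' <= w -> (step_poly a N).[expR (- w)] <= e &
    forall w, th' <= w -> a%:R * N%:R * expR (- w) ^+ a <= e * expR (- w)].
Proof.
move=> th0 thth' e0.
have [k k0 kE] : exists2 k, 0 < k & k = (th' - th) / 2.
  by exists ((th' - th) / 2) => //; rewrite divr_gt0 // subr_gt0.
pose t := (th' + th) / 2.
(* The first lower bound on a gives a k >= 1/e, which settles the plateau; the second beats the
   factor a N, because exp(a k) >= (a k)^2 / 4. *)
have C1 : 0 < (e * k)^-1 by rewrite invr_gt0 mulr_gt0.
have C2 : 0 < 8 * expR th' / (e * k ^+ 2).
  by apply: divr_gt0; apply: mulr_gt0 => //; rewrite ?expR_gt0 ?exprn_gt0.
have [a a1 [aC1 aC2]] : exists2 a : nat, 1 < a%:R :> R &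
    (e * k)^-1 <= a%:R /\ 8 * expR th' / (e * k ^+ 2) <= a%:R.
  exists (Num.truncn (1 + (e * k)^-1 + 8 * expR th' / (e * k ^+ 2))).+1.
    by apply: lt_trans (truncnS_gt _); rewrite -addrA ltrDl addr_gt0.
  have := truncnS_gt (1 + (e * k)^-1 + 8 * expR th' / (e * k ^+ 2)); lra.
have a0 : 0 < a%:R :> R by exact: lt_trans a1.
have [N N1 N2] : exists2 N : nat, expR (a%:R * t) <= N%:R & N%:R <= 2 * expR (a%:R * t).
  exists (Num.truncn (expR (a%:R * t))).+1; first by rewrite ltW // truncnS_gt.
  have le : 1 <= expR (a%:R * t).
    by rewrite -expR0 ler_expR mulr_ge0 ?ler0n // /t; lra.
  by rewrite -natr1 -[2]/(1 + 1) mulrDl mul1r lerD // truncn_le // expR_ge0.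
have a0n : (0 < a)%N by rewrite -(ltr0n R).
have N0n : (0 < N)%N by rewrite -(ltr0n R) (lt_le_trans (expR_gt0 _) N1).
have Xa w : expR (- w) ^+ a = expR (- (a%:R * w)) by rewrite -expRM_natl mulrN.
have H5 w : th' <= w -> a%:R * N%:R * expR (- w) ^+ a <= e * expR (- w).
  move=> thw; rewrite Xa.
  have E1 : a%:R * N%:R * expR (- (a%:R * w)) <= a%:R * (2 * expR (a%:R * t)) * expR (- (a%:R * w)).
    by rewrite ler_wpM2r ?expR_ge0 // ler_pM2l.
  apply: (le_trans E1).
  (* As a >= 1 and w >= th', a factor exp(- (w - th')) can be split off, and the gap still leaves
     exp(- a k). *)
  have E2 : expR (a%:R * t) * expR (- (a%:R * w)) <= expR (- w) * (expR th' * expR (- (a%:R * k))).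
    rewrite -!expRD ler_expR.
    have : (a%:R - 1) * (w - th') >= 0 by rewrite mulr_ge0 ?subr_ge0 // ltW.
    rewrite kE /t; lra.
  have E3 : a%:R * (2 * (expR th' * expR (- (a%:R * k)))) <= e.
    have E4 : (a%:R * k) ^+ 2 / 4 <= expR (a%:R * k).
      have ak : 0 <= a%:R * k / 2 by rewrite divr_ge0 // mulr_ge0 // ltW.
      have := expR_ge1Dx (a%:R * k / 2) => h.
      have -> : a%:R * k = a%:R * k / 2 * 2%:R by field.
      rewrite (expRM_natr 2).
      have : (a%:R * k / 2) ^+ 2 <= expR (a%:R * k / 2) ^+ 2.
        by rewrite lerXn2r ?nnegrE ?expR_ge0 //; lra.
      by rewrite !exprMn; lra.
    rewrite expRN !mulrA ler_pdivrMr ?expR_gt0 //.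
    apply: le_trans (ler_wpM2l (ltW e0) E4).
    move: aC2; rewrite ler_pdivrMr ?mulr_gt0 ?exprn_gt0 // => h.
    have := ler_wpM2l (ltW a0) h; rewrite exprMn !expr2; lra.
  have -> : a%:R * (2 * expR (a%:R * t)) * expR (- (a%:R * w)) =
    a%:R * 2 * (expR (a%:R * t) * expR (- (a%:R * w))) by ring.
  apply: le_trans (ler_wpM2l _ E2) _; first by rewrite mulr_ge0 ?ler0n.
  have := ler_wpM2r (expR_ge0 (- w)) E3; apply: le_trans.
  by rewrite le_eqVlt; apply/orP; left; apply/eqP; ring.
exists a, N; split => //.
- move=> w w0 wth; rewrite horner_step_poly Xa lerBlDr addrC -lerBlDr opprB addrC subrK.
  have h0 : 0 <= 1 - expR (- (a%:R * w)).
    by have /andP[_ ] := expRN_unit (mulr_ge0 (ltW a0) w0); rewrite subr_ge0.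
  have h1 : 1 - expR (- (a%:R * w)) <= expR (- expR (- (a%:R * w))) by exact: expR_ge1Dx.
  have h2 : (1 - expR (- (a%:R * w))) ^+ N <= expR (- (N%:R * expR (- (a%:R * w)))).
    move: h0 h1; set X := expR (- (a%:R * w)) => h0 h1.
    by rewrite -mulrN expRM_natl lerXn2r ?nnegrE ?expR_ge0.
  apply: (le_trans h2).
  have h3 : a%:R * k <= N%:R * expR (- (a%:R * w)).
    apply: (@le_trans _ _ (expR (a%:R * t) * expR (- (a%:R * w)))).
      rewrite -expRD; apply: le_trans (expR_ge1Dx _).
      have -> : a%:R * t + - (a%:R * w) = a%:R * k + a%:R * (th - w).
        by rewrite kE /t; field.
      by rewrite addrCA lerDl addr_ge0 // mulr_ge0 ?subr_ge0 // ltW.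
    by rewrite ler_wpM2r ?expR_ge0.
  have h4 : e^-1 <= a%:R * k.
    by rewrite -ler_pdivrMr // -invfM.
  rewrite expRN -[leRHS]invrK lef_pV2 ?posrE ?expR_gt0 ?invr_gt0 //.
  apply: le_trans (expR_ge1Dx _); lra.
- move=> w thw; have w0 : 0 <= w by lra.
  have /andP[x0 x1] := expRN_unit w0.
  rewrite horner_step_poly; apply: le_trans (bernoulli_onem _ _) _.
    by rewrite exprn_ge0 //= exprn_ile1.
  apply: (@le_trans _ _ (a%:R * N%:R * expR (- w) ^+ a)).
    by rewrite ler_wpM2r ?exprn_ge0 // ler_peMl ?ler0n // ler1n.
  by apply: (le_trans (H5 _ thw)); rewrite ler_piMr // ltW.
Qed.

Lemma Rintegral_lincomb (n : nat) (c : nat -> R) (f : nat -> R -> R) :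
  (forall i, mu.-integrable `]0, +oo[ (EFin \o f i)) ->
  mu.-integrable `]0, +oo[ (EFin \o (fun x => \sum_(i < n) c i * f i x)) /\
  \int[mu]_(x in `]0, +oo[) (\sum_(i < n) c i * f i x) =
    \sum_(i < n) c i * \int[mu]_(x in `]0, +oo[) f i x.
Proof.
move=> fi; elim: n => [|n [IH1 IH2]].
  under [X in EFin \o X]eq_fun do rewrite big_ord0.
  split; first exact: integrable0.
  by under eq_Rintegral do rewrite big_ord0; rewrite big_ord0 Rintegral_cst // mul0r.
have ci : mu.-integrable `]0, +oo[ (EFin \o (fun x => c n * f n x)).
  exact: (integrableZl _ (c n) (fi n)).
split.
  under [X in EFin \o X]eq_fun do rewrite big_ord_recr /=.
  exact: (integrableD _ IH1 ci).
under eq_Rintegral do rewrite big_ord_recr /=.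
by rewrite RintegralD // IH2 RintegralZl // big_ord_recr.
Qed.

Lemma exp_poly_integral (m : nat) (P : {poly R}) (s : R) :
  let f v := \sum_(j < size P) (P`_j * expR (- (j%:R * s))) *
               (Num.sqrt v ^+ m * (j%:R * expR (- (j%:R * v)))) in
  mu.-integrable `]0, +oo[ (EFin \o f) /\
  \int[mu]_(v in `]0, +oo[) f v =
    \sum_(j < size P) (P`_j * expR (- (j%:R * s))) * sqrt_exp_int m j%:R.
Proof.
move=> f; apply: (@Rintegral_lincomb (size P) (fun j => P`_j * expR (- (j%:R * s)))
  (fun j v => Num.sqrt v ^+ m * (j%:R * expR (- (j%:R * v))))).
case=> [|j]; last exact: sqrt_exp_integrable.
under [X in EFin \o X]eq_fun do rewrite mul0r mulr0.
exact: integrable0.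
Qed.

(* Total mass of the weight P(exp(- |x|^2)) on the hyperplane u.x = y of (m+1)-space; the term
   j = 0, where pi / 0 = 0, is harmless because P has no constant term below. *)
Definition radial_profile (m : nat) (P : {poly R}) (y : R) : R :=
  \sum_(j < size P) P`_j * Num.sqrt (pi / j%:R) ^+ m * expR (- (j%:R * y ^+ 2)).

(** With x = exp(- (v + s)), x P'(x) is minus the v-derivative of P(x): the layer-cake density of
    the weight P(exp(- |.|^2)) on a hyperplane at squared distance s from the origin. *)
Lemma exp_poly_deriv (m : nat) (P : {poly R}) (s v : R) :
  \sum_(j < size P) (P`_j * expR (- (j%:R * s))) *
               (Num.sqrt v ^+ m * (j%:R * expR (- (j%:R * v)))) =
  Num.sqrt v ^+ m * (expR (- (v + s)) * P^`().[expR (- (v + s))]).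
Proof.
transitivity (Num.sqrt v ^+ m * \sum_(j < size P) P`_j * j%:R * expR (- (v + s)) ^+ j).
  rewrite mulr_sumr; apply: eq_bigr => j _.
  rewrite (_ : expR (- (v + s)) ^+ j = expR (- (j%:R * s)) * expR (- (j%:R * v))); last first.
    by rewrite -expRM_natl -expRD; congr expR; ring.
  ring.
congr (_ * _); set x := expR _.
have -> : P^`().[x] = \sum_(j < size P) P`_j * j%:R * x ^+ j.-1.
  rewrite {1}(_ : P = \sum_(j < size P) P`_j *: 'X^j); last first.
    by rewrite -[LHS]coefK poly_def.
  rewrite linear_sum horner_sum; apply: eq_bigr => j _.
  by rewrite linearZ /= derivXn !hornerE hornerMn hornerXn -mulr_natl mulrA.
rewrite mulr_sumr; apply: eq_bigr => -[[|j] /= _ ] _; first by rewrite mulr0 !mul0r mulr0.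
rewrite exprS; ring.
Qed.

Lemma step_poly_deriv a N (x : R) : (0 < a)%N ->
  x * (step_poly a N)^`().[x] = a%:R * N%:R * x ^+ a * (1 - x ^+ a) ^+ N.-1.
Proof.
case: a => // a _.
rewrite /step_poly derivB derivC sub0r deriv_exp derivB derivC sub0r derivXn.
rewrite !(hornerM, hornerN, hornerMn, hornerXn, horner_exp, hornerD, hornerC) /=.
rewrite -[_ *+ N]mulr_natr -[_ *+ a.+1]mulr_natr exprS; ring.
Qed.

(* x P'(x) is nonnegative and concentrated near the step, so the Gamma integral of v^(m/2) against
   it is essentially the value of v^(m/2) at the step. *)
Lemma radial_profile_step_le m a N (e th y : R) : (0 < m)%N -> (0 < a)%N -> (0 < N)%N -> 0 <= e ->
  (forall w, th <= w -> a%:R * N%:R * expR (- w) ^+ a <= e * expR (- w)) ->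
  radial_profile m (step_poly a N) y <=
    ball_volume R m * Num.sqrt (th - y ^+ 2) ^+ m + e * Num.sqrt pi ^+ m * expR (- y ^+ 2).
Proof.
move=> m0 a0 N0 e0 H.
set P := step_poly a N.
pose f k v := \sum_(j < size P) (P`_j * expR (- (j%:R * y ^+ 2))) *
               (Num.sqrt v ^+ k * (j%:R * expR (- (j%:R * v)))).
have [i1 E1] := exp_poly_integral m P (y ^+ 2).
have [i2 E2] := exp_poly_integral 0 P (y ^+ 2).
rewrite -/(f m) in i1 E1; rewrite -/(f 0%N) in i2 E2.
have P0 : P`_0 = 0.
  by rewrite -horner_coef0 horner_step_poly expr0n gtn_eqF // subr0 expr1n subrr.
have -> : radial_profile m P y = ball_volume R m * \int[mu]_(v in `]0, +oo[) f m v.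
  rewrite E1 mulr_sumr; apply: eq_bigr => -[[|j] /= _] _; first by rewrite P0 !mul0r mulr0.
  rewrite gauss_gamma //; ring.
(* For m = 0 the layer cake gives back P(exp(- y^2)), a value of the step on [0, 1]; so the density
   has mass at most 1. *)
have I2 : \int[mu]_(v in `]0, +oo[) f 0%N v <= 1.
  rewrite E2.
  have -> : \sum_(j < size P) P`_j * expR (- (j%:R * y ^+ 2)) *
    sqrt_exp_int 0 j%:R = P.[expR (- y ^+ 2)].
    rewrite horner_coef; apply: eq_bigr => -[[|j] /= _] _; first by rewrite P0 !mul0r.
    rewrite -expRM_natl mulrN (_ : sqrt_exp_int 0 _ = 1) ?mulr1 //.
    rewrite /sqrt_exp_int /Rintegral; under eq_integral do rewrite expr0 mul1r.
    by rewrite integral_exp_decay.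
  by have /andP[] := step_poly_ge0_le1 a N (expRN_unit (sqr_ge0 y)).
have V0 := ball_volume_gt0 R m.
have sp : Num.sqrt pi ^+ m = ball_volume R m * sqrt_exp_int m 1.
  by rewrite -gauss_gamma // divr1.
rewrite sp (_ : e * _ * _ = ball_volume R m * (e * expR (- y ^+ 2) * sqrt_exp_int m 1));
  last by ring.
rewrite -mulrDr ler_pM2l //.
set S := Num.sqrt (th - y ^+ 2) ^+ m.
have S0 : 0 <= S by rewrite exprn_ge0 // sqrtr_ge0.
have ie : mu.-integrable `]0, +oo[ (EFin \o (fun v : R =>
  Num.sqrt v ^+ m * (1 * expR (- (1 * v))))).
  exact: sqrt_exp_integrable.
have j1 : mu.-integrable `]0, +oo[ (EFin \o (fun v : R => S * f 0%N v)).
  exact: (integrableZl _ S i2).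
have j2 : mu.-integrable `]0, +oo[ (EFin \o (fun v : R =>
  e * expR (- y ^+ 2) * (Num.sqrt v ^+ m * (1 * expR (- (1 * v)))))).
  exact: (integrableZl _ (e * expR (- y ^+ 2)) ie).
apply: (@le_trans _ _ (\int[mu]_(v in `]0, +oo[) (S * f 0%N v +
  e * expR (- y ^+ 2) * (Num.sqrt v ^+ m * (1 * expR (- (1 * v))))))).
  apply: le_Rintegral => //; first exact: (integrableD _ j1 j2).
  move=> v; rewrite /= in_itv /= andbT => v0.
  rewrite /f !exp_poly_deriv expr0 mul1r step_poly_deriv //.
  set x := expR (- (v + y ^+ 2)).
  have /andP[x0 x1] : 0 <= x <= 1 by apply: expRN_unit; rewrite addr_ge0 ?sqr_ge0 // ltW.
  have xa0 : 0 <= x ^+ a by rewrite exprn_ge0.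
  have h0 : 0 <= 1 - x ^+ a by rewrite subr_ge0 exprn_ile1.
  have h1 : (1 - x ^+ a) ^+ N.-1 <= 1 by rewrite exprn_ile1 // lerBlDr lerDl.
  have K0 : 0 <= a%:R * N%:R * x ^+ a * (1 - x ^+ a) ^+ N.-1.
    by rewrite !mulr_ge0 ?ler0n ?exprn_ge0.
  (* Before the step, v^(m/2) is at most its value [S] at the step; beyond it, [H] bounds the
     density by e exp(- v - y^2). If y^2 > th only the second case occurs. *)
  have [vle|vgt] := lerP v (th - y ^+ 2).
    apply: (@le_trans _ _ (S * (a%:R * N%:R * x ^+ a * (1 - x ^+ a) ^+ N.-1))).
      by rewrite ler_wpM2r // /S lerXn2r ?nnegrE ?sqrtr_ge0 // ler_wsqrtr.
    by rewrite lerDl !mulr_ge0 ?expR_ge0 ?exprn_ge0 ?sqrtr_ge0.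
  apply: (@le_trans _ _ (Num.sqrt v ^+ m * (e * x))); last first.
    apply: (@le_trans _ _ (e * expR (- y ^+ 2) * (Num.sqrt v ^+ m * (1 * expR (- (1 * v)))))).
      rewrite /x opprD expRD !mul1r le_eqVlt; apply/orP; left; apply/eqP; ring.
    by rewrite lerDr mulr_ge0.
  rewrite ler_wpM2l ?exprn_ge0 ?sqrtr_ge0 //.
  apply: le_trans (H (v + y ^+ 2) _); last by lra.
  by rewrite -/x ler_piMr // !mulr_ge0 ?ler0n.
rewrite RintegralD // RintegralZl // RintegralZl //.
by rewrite lerD2r ler_piMr.
Qed.
End step_poly.

(** * Riemann sums over boxes *)

Section box.
Variables (R : realType) (m : nat).
Notation n := m.+1.
Implicit Types (h : R) (M : nat) (u th : 'I_n -> R) (P Q : {poly R}).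

Definition grid h M (k : nat) : R := h * (k%:R - M%:R).
Definition gridv h M th (z : {ffun 'I_n ->
  'I_(M.*2)}) (i : 'I_n) : R := h * ((z i)%:R - M%:R + th i).
Definition grid_normsq h M th (z : {ffun 'I_n -> 'I_(M.*2)}) : R := \sum_i gridv h th z i ^+ 2.
Definition grid_dot h M u th (z : {ffun 'I_n -> 'I_(M.*2)}) : R := \sum_i u i * gridv h th z i.

(* Convergence to 0 as M h -> oo and M h^2 -> 0, uniformly in the direction u and the shift th. *)
Definition negligible (D : R -> nat -> ('I_n -> R) -> ('I_n -> R) -> R) : Prop :=
  forall e, 0 < e -> exists B d, [/\ 0 < B, 0 < d & forall h M u th,
    0 < h -> h <= 1 -> \sum_i u i ^+ 2 = 1 -> (forall i, `|th i| <= 1) ->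
    B <= M%:R * h -> M%:R * h ^+ 2 <= d -> `|D h M u th| <= e].

Lemma negligible_lincomb (I : eqType) (r : seq I) (c : I -> R) D :
  (forall i, c i != 0 -> negligible (D i)) ->
  negligible (fun h M u th => \sum_(i <- r) c i * D i h M u th).
Proof.
move=> HD; elim: r => [|i r IH] e e0.
  by exists 1, 1; split => // *; rewrite big_nil normr0 ltW.
have e20 : 0 < e / 2 by rewrite divr_gt0.
have [B1 [d1 [B10 d10 H1]]] := IH _ e20.
have [c0|cn0] := eqVneq (c i) 0.
  exists B1, d1; split => // h M u th h0 h1 u1 th1 BM dM.
  rewrite big_cons c0 mul0r add0r; apply: le_trans (H1 _ _ _ _ h0 h1 u1 th1 BM dM) _; lra.
have e30 : 0 < e / 2 / `|c i| by rewrite divr_gt0 // normr_gt0.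
have [B2 [d2 [B20 d20 H2]]] := HD _ cn0 _ e30.
exists (Num.max B1 B2), (Num.min d1 d2); split.
- by rewrite lt_max B10.
- by rewrite lt_min d10.
move=> h M u th h0 h1 u1 th1; rewrite ge_max le_min => /andP[b1 b2] /andP[c1 c2].
have := H1 _ _ _ _ h0 h1 u1 th1 b1 c1; have := H2 _ _ _ _ h0 h1 u1 th1 b2 c2.
rewrite big_cons ler_pdivlMr ?normr_gt0 // => k1 k2.
apply: le_trans (ler_normD _ _) _; rewrite normrM mulrC; lra.
Qed.

Lemma prod_close (k : nat) (G : 'I_k -> R) (L e : R) : 0 <= L -> 0 <= e -> e <= 1 ->
  (forall i, `|G i - L| <= e) -> `|\prod_i G i - L ^+ k| <= k%:R * e * (L + 1) ^+ k.
Proof.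
move=> L0 e0 e1; elim: k G => [|k IH] G HG.
  by rewrite big_ord0 expr0 subrr normr0 !mul0r.
rewrite big_ord_recr /=.
have := IH (fun i => G (widen_ord (leqnSn k) i)) (fun i => HG _).
set A := \prod_(i < k) _ => HA; set g := G ord_max.
have Hg : `|g - L| <= e := HG _.
have -> : A * g - L ^+ k.+1 = (A - L ^+ k) * g + L ^+ k * (g - L) by rewrite exprSr; ring.
apply: le_trans (ler_normD _ _) _; rewrite !normrM (ger0_norm (exprn_ge0 _ L0)).
have g1 : `|g| <= L + 1.
  have := ler_normD (g - L) L; rewrite subrK (ger0_norm L0); lra.
have p1 : L ^+ k <= (L + 1) ^+ k by rewrite lerXn2r ?nnegrE ?addr_ge0 // lerDl.
have p2 : (L + 1) ^+ k <= (L + 1) ^+ k.+1 by rewrite exprS ler_peMl ?exprn_ge0 ?addr_ge0 // lerDr.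
have q1 : `|A - L ^+ k| * `|g| <= k%:R * e * (L + 1) ^+ k * (L + 1) by rewrite ler_pM.
have q2 : L ^+ k * `|g - L| <= (L + 1) ^+ k.+1 * e by rewrite ler_pM // ?exprn_ge0 // (le_trans p1).
apply: le_trans (lerD q1 q2) _; rewrite -natr1 exprSr le_eqVlt; apply/orP; left; apply/eqP; ring.
Qed.

Lemma complete_square h M u th (z : {ffun 'I_n -> 'I_(M.*2)}) (p q : R) : 0 < p ->
  \sum_i u i ^+ 2 = 1 ->
  - (p * grid_normsq h th z) + q * grid_dot h u th z =
  q ^+ 2 / (4 * p) + \sum_i - (p * (h * ((z i)%:R - M%:R) + (h * th i - q * u i / (2 * p))) ^+ 2).
Proof.
move=> p0 u1.
have -> : q ^+ 2 / (4 * p) = \sum_i q ^+ 2 / (4 * p) * u i ^+ 2.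
  by rewrite -mulr_sumr u1 mulr1.
rewrite /grid_normsq /grid_dot !mulr_sumr -sumrN -!big_split /=; apply: eq_bigr => i _;
  rewrite /gridv.
by field; rewrite gt_eqF.
Qed.

(* The one-dimensional sum over the same grid stands for the integral over y = u.x. *)
Lemma gauss_box (p q : R) : 0 < p ->
  negligible (fun h M u th =>
   h ^+ n * (\sum_(z : {ffun 'I_n ->
     'I_(M.*2)}) expR (- (p * grid_normsq h th z) + q * grid_dot h u th z))
   - Num.sqrt (pi / p) ^+ m * (h * \sum_(j < M.*2) expR (- (p * grid h M j ^+ 2) +
       q * grid h M j))).
Proof.
move=> p0 e e0.
set S := expR (q ^+ 2 / (4 * p)); set L := Num.sqrt (pi / p).
have S0 : 0 < S := expR_gt0 _.
have L0 : 0 <= L := sqrtr_ge0 _.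
(* A bound for every translation h th_i - q u_i / (2p), since h, |th_i| and |u_i| are at most 1. *)
pose C := 1 + `|q| / (2 * p).
pose K := S * (n%:R * (L + 1) ^+ n + L ^+ m) + 1.
have K0 : 0 < K by rewrite ltr_wpDl // !(mulr_ge0, addr_ge0, exprn_ge0) // ltW.
have eK : 0 < Num.min 1 (e / K) by rewrite lt_min ltr01 divr_gt0.
have [B [d [B0 d0 H]]] := gauss_riemann C p0 eK.
exists B, d; split => // h M u th h0 h1 u1 th1 BM dM.
have q2 : `|q / (2 * p)| = `|q| / (2 * p) by rewrite normrM [`|_^-1|]ger0_norm //
  invr_ge0 mulr_ge0 // ltW.
pose G c := h * (\sum_(j < M.*2) expR (- (p * (h * (j%:R - M%:R) + c) ^+ 2))).
have -> : h ^+ n * (\sum_(z : {ffun 'I_n ->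
  'I_(M.*2)}) expR (- (p * grid_normsq h th z) + q * grid_dot h u th z)) =
   S * \prod_i G (h * th i - q * u i / (2 * p)).
  rewrite /G big_split /= prodr_const card_ord bigA_distr_bigA /= mulrCA; congr (_ * _).
  rewrite mulr_sumr; apply: eq_bigr => z _.
  by rewrite complete_square // expRD expR_sum.
have -> : h * (\sum_(j < M.*2) expR (- (p * grid h M j ^+ 2) +
  q * grid h M j)) = S * G (- (q / (2 * p))).
  rewrite /G mulrCA; congr (_ * _); rewrite mulr_sumr; apply: eq_bigr => j _.
  by rewrite -expRD /grid; congr expR; field; rewrite gt_eqF.
have HG i : `|G (h * th i - q * u i / (2 * p)) - L| <= Num.min 1 (e / K).
  apply: H => //; apply: le_trans (ler_normB _ _) _; apply: lerD.
    by rewrite normrM mulr_ile1 // ger0_norm // ltW.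
  rewrite mulrAC normrM q2 ler_piMr // ?divr_ge0 ?mulr_ge0 ?(ltW p0) //.
  rewrite -(ler_pXn2r (n:=2)) ?nnegrE // expr1n real_normK ?num_real // -u1.
  by rewrite (bigD1 i) //= lerDl sumr_ge0 // => j _; rewrite sqr_ge0.
have HG' : `|G (- (q / (2 * p))) - L| <= Num.min 1 (e / K).
  by apply: H => //; rewrite normrN q2 lerDr.
have H1 := prod_close L0 (ltW eK) _ HG.
have m1 : Num.min 1 (e / K) <= 1 by rewrite ge_min lexx.
have m2 : Num.min 1 (e / K) <= e / K by rewrite ge_min lexx orbT.
have {H1} H1 := H1 m1; move: H1 HG' m2 eK; set ee := Num.min _ _; set PG := \prod_i _;
  set g := G _ => H1 Hg m2 eK.
have -> : S * PG - L ^+ m * (S * g) = S * ((PG - L ^+ n) + L ^+ m * (L - g)) by rewrite exprS; ring.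
rewrite normrM (ger0_norm (ltW S0)).
apply: (@le_trans _ _ (S * (n%:R * ee * (L + 1) ^+ n + L ^+ m * ee))).
  rewrite ler_pM2l //; apply: le_trans (ler_normD _ _) _; apply: lerD => //.
  by rewrite normrM distrC (ger0_norm (exprn_ge0 _ L0)) ler_wpM2l ?exprn_ge0.
have -> : S * (n%:R * ee * (L + 1) ^+ n + L ^+ m * ee) = (K - 1) * ee by rewrite /K; ring.
apply: (@le_trans _ _ (K * ee)); first by rewrite ler_wpM2r ?(ltW eK) // gerBl.
by rewrite mulrC -ler_pdivlMr.
Qed.

(** Linearity in the monomials of P and Q. A constant term of P would leave exponentials without
    Gaussian decay, whose sums over growing boxes diverge. *)
Lemma poly_box P Q : P`_0 = 0 ->
  negligible (fun h M u th =>
   h ^+ n * (\sum_(z : {ffun 'I_n ->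
     'I_(M.*2)}) P.[expR (- grid_normsq h th z)] * Q.[expR (grid_dot h u th z)])
   - h * \sum_(j < M.*2) Q.[expR (grid h M j)] * radial_profile m P (grid h M j)).
Proof.
move=> P0.
pose c (ab : nat * nat) := P`_ab.1 * Q`_ab.2.
pose D (ab : nat * nat) h M u th :=
   h ^+ n * (\sum_(z : {ffun 'I_n ->
     'I_(M.*2)}) expR (- (ab.1%:R * grid_normsq h th z) + ab.2%:R * grid_dot h u th z))
   - Num.sqrt (pi / ab.1%:R) ^+ m * (h * \sum_(j < M.*2) expR (- (ab.1%:R * grid h M j ^+ 2) +
       ab.2%:R * grid h M j)).
pose r := [seq (a, b) | a <- iota 0 (size P), b <- iota 0 (size Q)].
have N : negligible (fun h M u th => \sum_(i <- r) c i * D i h M u th).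
  apply: negligible_lincomb => -[[|a] b]; rewrite /c /=; first by rewrite P0 mul0r eqxx.
  by move=> _; apply: gauss_box; rewrite ltr0n.
move=> e e0; have [B [d [B0 d0 H]]] := N e e0.
exists B, d; split => // h M u th h0 h1 u1 th1 BM dM.
have := H _ _ _ _ h0 h1 u1 th1 BM dM; congr (`| _ | <= _).
have PQ x y : P.[expR (- x)] * Q.[expR y] =
    \sum_(i <- r) c i * expR (- (i.1%:R * x) + i.2%:R * y).
  rewrite big_allpairs_dep /= horner_coef -(big_mkord xpredT (fun i => P`_i * expR (- x) ^+ i)).
  rewrite mulr_suml /index_iota subn0; apply: eq_bigr => a _.
  rewrite horner_coef -(big_mkord xpredT (fun i => Q`_i * expR y ^+ i)) mulr_sumr /index_iota subn0.
  apply: eq_bigr => b _; rewrite /c /= expRD -mulrN !expRM_natl; ring.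
have PR y : Q.[expR y] * radial_profile m P y =
    \sum_(i <- r) c i * (Num.sqrt (pi / i.1%:R) ^+ m * expR (- (i.1%:R * y ^+ 2) + i.2%:R * y)).
  rewrite big_allpairs_dep /= /radial_profile.
  rewrite -(big_mkord xpredT (fun j =>
    P`_j * Num.sqrt (pi / j%:R) ^+ m * expR (- (j%:R * y ^+ 2)))).
  rewrite mulr_sumr /index_iota subn0; apply: eq_bigr => a _.
  rewrite horner_coef -(big_mkord xpredT (fun i => Q`_i * expR y ^+ i)) mulr_suml /index_iota subn0.
  apply: eq_bigr => b _; rewrite /c /= expRD expRM_natl; ring.
under eq_bigr do rewrite /D mulrBr.
rewrite sumrB; congr (_ - _).
  under [in RHS]eq_bigr do rewrite PQ.
  rewrite exchange_big /= mulr_sumr; apply: eq_bigr => i _.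
  by rewrite mulrCA mulr_sumr.
under [in RHS]eq_bigr do rewrite PR.
rewrite exchange_big /= mulr_sumr; apply: eq_bigr => i _.
rewrite -mulr_sumr -mulr_sumr; ring.
Qed.

(** This controls the remainder exp(- y^2) of [radial_profile_step_le] against Q, which grows like a
    power of exp y. C depends on Q alone, so the radial step can be chosen after Q. *)
Lemma gauss_poly_grid_bounded Q : exists2 C, 0 < C & exists B d, [/\ 0 < B, 0 < d & forall h M,
    0 < h -> B <= M%:R * h -> M%:R * h ^+ 2 <= d ->
    h * (\sum_(j < M.*2) Q.[expR (grid h M j)] * expR (- grid h M j ^+ 2)) <= C].
Proof.
pose I b h M := h * \sum_(j < M.*2) expR (grid h M j) ^+ b * expR (- grid h M j ^+ 2).
have H (s : seq nat) : exists2 C, 0 < C & exists B d, [/\ 0 < B, 0 < d & forall h M,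
    0 < h -> B <= M%:R * h -> M%:R * h ^+ 2 <= d ->
    \sum_(b <- s) Q`_b * I b h M <= C].
  elim: s => [|b s [C C0 [B [d [B0 d0 IH]]]]].
    exists 1 => //; exists 1, 1; split => // *; rewrite big_nil //.
  have [B' [d' [B'0 d'0 H]]] := gauss_riemann (`|b%:R / 2|) (@ltr01 R) (@ltr01 R).
  pose S : R := expR (b%:R ^+ 2 / 4).
  exists (C + `|Q`_b| * (S * (Num.sqrt (pi / 1) + 1))).
    by rewrite ltr_pwDl // !mulr_ge0 ?expR_ge0 ?addr_ge0 ?sqrtr_ge0.
  exists (Num.max B B'), (Num.min d d'); split.
  - by rewrite lt_max B0.
  - by rewrite lt_min d0.
  move=> h M h0; rewrite ge_max le_min => /andP[b1 b2] /andP[c1 c2].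
  rewrite big_cons addrC lerD ?IH //.
  have Hh := H h (- (b%:R / 2)) M h0 _ b2 c2.
  rewrite normrN in Hh; have {Hh} Hh := Hh (lexx _).
  have E : I b h M = S * (h * (\sum_(j < M.*2) expR (- (1 * (h * (j%:R - M%:R) +
    - (b%:R / 2)) ^+ 2)))).
    rewrite /I mulrCA; congr (_ * _); rewrite mulr_sumr; apply: eq_bigr => j _.
    by rewrite -expRM_natl -!expRD /grid; congr expR; field.
  have I0 : 0 <= I b h M.
    by rewrite mulr_ge0 ?(ltW h0) // sumr_ge0 // => j _; rewrite mulr_ge0 ?exprn_ge0 ?expR_ge0.
  apply: (@le_trans _ _ (`|Q`_b| * I b h M)); first by rewrite ler_wpM2r // ler_norm.
  rewrite ler_wpM2l // E ler_wpM2l ?expR_ge0 //.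
  move: Hh; rewrite ler_norml => /andP[_]; lra.
have [C C0 [B [d [B0 d0 {}H]]]] := H (iota 0 (size Q)).
exists C => //; exists B, d; split => // h M h0 b1 c1.
have := H h M h0 b1 c1; congr (_ <= _).
under [in RHS]eq_bigr => j _.
  rewrite horner_coef -(big_mkord xpredT (fun i =>
    Q`_i * expR (grid h M j) ^+ i)) mulr_suml /index_iota subn0.
  over.
rewrite exchange_big /= mulr_sumr; apply: eq_bigr => b _.
by rewrite /I mulrCA; congr (_ * _); rewrite mulr_sumr; apply: eq_bigr => j _; rewrite mulrA.
Qed.

Lemma progression_count h (x a b : R) (K : nat) : 0 < h -> a <= b ->
  h * (\sum_(j < K) ((a <= x + h * j%:R) && (x + h * j%:R <= b))%:R) <= b - a + h.
Proof.
move=> h0 ab.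
(* The induction also records the position reached: once a term has been counted, all counted terms
   lie between a and the next term x + h K. *)
suff : \sum_(j < K) ((a <= x + h * j%:R) && (x + h * j%:R <= b))%:R = 0 :> R \/
    h * (\sum_(j < K) ((a <= x + h * j%:R) && (x + h * j%:R <= b))%:R) <= x + h * K%:R - a /\
    h * (\sum_(j < K) ((a <= x + h * j%:R) && (x + h * j%:R <= b))%:R) <= b - a + h.
  by case=> [->|[_ //]]; rewrite mulr0; lra.
elim: K => [|K IH]; first by left; rewrite big_ord0.
rewrite big_ord_recr /= -[K.+1%:R]natr1 !mulrDr mulr1.
move: IH; set c := \sum_(j < K) _; case: (boolP (_ && _)) => [/andP[h1 h2]|_]; last first.
  rewrite addr0 mulr0 addr0 => -[->|[c1 c2]]; [by left|right; lra].
by rewrite mulr1 => -[->|[c1 c2]]; right; rewrite ?mulr0; lra.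
Qed.

Lemma grid_count h M (a b : R) : 0 < h -> a <= b ->
  h * (\sum_(j < M.*2) ((a <= grid h M j) && (grid h M j <= b))%:R) <= b - a + h.
Proof.
move=> h0 ab; have := progression_count (- (h * M%:R)) M.*2 h0 ab; congr (_ * _ <= _).
by apply: eq_bigr => j _; rewrite /grid mulrBr addrC.
Qed.
End box.

(** * Lattice points in a slab of the ball *)

Section slab.
Variables (R : realType) (m : nat).
Hypothesis m0 : (0 < m)%N.
Notation n := m.+1.
Notation V := (ball_volume R m).

(* For y > 3 the step polynomials are evaluated outside [0, 1], and only the positivity of Q
   survives there: it comes from taking a square. *)
Lemma exists_window (al be t : R) : al <= be -> be < 2 -> 0 < t -> t < 1 / 4 ->
  exists Q : {poly R}, [/\ forall y, 0 <= Q.[expR y],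
    forall y, al <= y -> y <= be -> 1 <= Q.[expR y],
    forall y, y <= 3 -> Q.[expR y] <= (1 - t) ^- 4 &
    forall y, y <= 3 -> (y <= al - t) || (be + t <= y) -> Q.[expR y] <= t ^+ 2 * (1 - t) ^- 4].
Proof.
move=> albe be2 t0 t4.
(* In the variable w = 3 - y, nonnegative for y <= 3, p1 switches on between al - t and al, and 1 -
   p2 switches off between be and be + t. The offset 3 exceeds be + t, so all thresholds are
   positive. On [al, be] both factors are at least 1 - t, whence the normalization by (1 - t)^4 of
   the squared product. *)
have [a1 [N1 [_ _ A1 B1 _]]] : exists a N, [/\ (0 < a)%N, (0 < N)%N,
    forall w, 0 <= w -> w <= 3 - al -> 1 - t <= (step_poly R a N).[expR (- w)],
    forall w, 3 - al + t <= w -> (step_poly R a N).[expR (- w)] <= t &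
    forall w, 3 - al + t <= w -> a%:R * N%:R * expR (- w) ^+ a <= t * expR (- w)].
  by apply: exists_step_poly => //; lra.
have [a2 [N2 [_ _ A2 B2 _]]] : exists a N, [/\ (0 < a)%N, (0 < N)%N,
    forall w, 0 <= w -> w <= 3 - be - t -> 1 - t <= (step_poly R a N).[expR (- w)],
    forall w, 3 - be <= w -> (step_poly R a N).[expR (- w)] <= t &
    forall w, 3 - be <= w -> a%:R * N%:R * expR (- w) ^+ a <= t * expR (- w)].
  by apply: exists_step_poly => //; lra.
pose p1 := step_poly R a1 N1; pose p2 := step_poly R a2 N2.
have k0 : 0 < (1 - t) ^- 4 by rewrite invr_gt0 exprn_gt0 //; lra.
pose T : {poly R} := (p1 * (1 - p2)) ^+ 2.
exists ((1 - t) ^- 4 *: (T \Po (expR (-3) *: 'X))).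
have E0 (q1 q2 : {poly R}) (k y : R) :
    (k *: (((q1 * (1 - q2)) ^+ 2) \Po (expR (-3) *: 'X))).[expR y] =
    k * (q1.[expR (- (3 - y))] * (1 - q2.[expR (- (3 - y))])) ^+ 2.
  rewrite hornerZ horner_comp hornerZ hornerX -expRD horner_exp hornerM hornerD hornerN hornerC.
  by rewrite (_ : - (3 - y) = - 3 + y) //; ring.
have E y := E0 p1 p2 ((1 - t) ^- 4) y.
have P1 y : y <= 3 -> 0 <= p1.[expR (- (3 - y))] <= 1.
  by move=> y3; apply: step_poly_ge0_le1; apply: expRN_unit; lra.
have P2 y : y <= 3 -> 0 <= p2.[expR (- (3 - y))] <= 1.
  by move=> y3; apply: step_poly_ge0_le1; apply: expRN_unit; lra.
split=> y; rewrite E.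
- by rewrite mulr_ge0 ?sqr_ge0 // ltW.
- move=> aly ybe; rewrite mulrC ler_pdivlMr ?mul1r ?exprn_gt0 //; last by lra.
  have q1 : 1 - t <= p1.[expR (- (3 - y))] by apply: A1; lra.
  have q2 : p2.[expR (- (3 - y))] <= t by apply: B2; lra.
  rewrite (_ : 4%N = (2 * 2)%N) // exprM; apply: lerXn2r; rewrite ?nnegrE ?sqr_ge0 //.
    by rewrite mulr_ge0; lra.
  by rewrite expr2 ler_pM; lra.
- move=> y3; have /andP[x0 x1] := P1 _ y3; have /andP[z0 z1] := P2 _ y3.
  rewrite -[leRHS]mulr1 ler_pM2l // exprn_ile1 //; first by rewrite mulr_ge0; lra.
  by rewrite mulr_ile1; lra.
move=> y3 /orP yy; have /andP[x0 x1] := P1 _ y3; have /andP[z0 z1] := P2 _ y3.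
rewrite [leRHS]mulrC ler_pM2l //; apply: lerXn2r; rewrite ?nnegrE ?(ltW t0) //.
  by rewrite mulr_ge0; lra.
case: yy => yy.
  have q1 : p1.[expR (- (3 - y))] <= t by apply: B1; lra.
  by rewrite -[leRHS]mulr1 ler_pM; lra.
have q2 : 1 - t <= p2.[expR (- (3 - y))] by apply: A2; lra.
by rewrite -[leRHS]mul1r ler_pM; lra.
Qed.

(** The left side is the cost of the majorant: 3 t is the widening 2 t of the window plus one grid
    step, and 2^m * 5 accounts for the rest of [-2, 2], where the square root is at most 2 and the
    length, with a grid step, at most 5. Continuity at t = 0 concludes. *)
Lemma slab_volume_perturb (al be e : R) : 0 < al -> 0 < e ->
  exists2 t, [/\ 0 < t, t < 1 / 4 & t < al] &
   V * ((1 - t) ^- 4 * Num.sqrt (1 + t - (al - t) ^+ 2) ^+ m * (be - al + 3 * t) +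
     t ^+ 2 * (1 - t) ^- 4 * 2 ^+ m * 5)
   <= V * Num.sqrt (1 - al ^+ 2) ^+ m * (be - al) + e.
Proof.
move=> al0 e0.
pose f (t : R) := V * ((1 - t) ^- 4 * Num.sqrt (1 + t - (al - t) ^+ 2) ^+ m * (be - al + 3 * t) +
     t ^+ 2 * (1 - t) ^- 4 * 2 ^+ m * 5).
have c0 : {for 0, continuous f}.
  have ci : {for (0:R), continuous (fun t : R => (1 - t) ^- 4)}.
    apply: cvgV; first by rewrite subr0 expr1n oner_eq0.
    apply: (@continuous_comp _ _ _ (fun t : R => 1 - t) (fun t => t ^+ 4));
      last exact: exprn_continuous.
    by apply: cvgB; [exact: cvg_cst|exact: cvg_id].
  have cs : {for (0:R), continuous (fun t : R => Num.sqrt (1 + t - (al - t) ^+ 2) ^+ m)}.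
    apply: (@continuous_comp _ _ _ (fun t : R => Num.sqrt (1 + t - (al - t) ^+ 2)) (fun t =>
      t ^+ m)); last exact: exprn_continuous.
    apply: (@continuous_comp _ _ _ (fun t : R => 1 + t - (al - t) ^+ 2) (@Num.sqrt R));
      last exact: sqrt_continuous.
    apply: cvgB; first by apply: cvgD; [exact: cvg_cst|exact: cvg_id].
    apply: (@continuous_comp _ _ _ (fun t : R => al - t) (fun t => t ^+ 2));
      last exact: exprn_continuous.
    by apply: cvgB; [exact: cvg_cst|exact: cvg_id].
  apply: cvgM; first exact: cvg_cst.
  apply: cvgD.
    apply: cvgM; first by apply: cvgM; [exact: ci|exact: cs].
    apply: cvgD; first exact: cvg_cst.
    by apply: cvgM; [exact: cvg_cst|exact: cvg_id].
  apply: cvgM; last exact: cvg_cst.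
  apply: cvgM; last exact: cvg_cst.
  by apply: cvgM; [exact: exprn_continuous|exact: ci].
have f0 : f 0 = V * Num.sqrt (1 - al ^+ 2) ^+ m * (be - al).
  by rewrite /f !subr0 expr1n invr1 !mulr0 addr0 expr0n /= !mul0r !addr0 mul1r mulrA.
move/cvgrPdist_le : c0 => /(_ _ e0) /nbhs_ballP[d /= d0 Hd].
pose t := Num.min (d / 2) (Num.min (1 / 8) (al / 2)).
have t0 : 0 < t by rewrite !lt_min !divr_gt0.
have t1 : t <= d / 2 by rewrite ge_min lexx.
have t2 : t <= 1 / 8 by rewrite !ge_min lexx orbT.
have t3 : t <= al / 2 by rewrite !ge_min lexx !orbT.
exists t; first by split=> //; lra.
have := Hd t; rewrite -/(f t) -f0 /ball /= sub0r normrN ger0_norm ?(ltW t0) // => /(_ _).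
have td : t < d by lra.
move=> /(_ td); rewrite distrC => h.
have := ler_norm (f t - f 0); lra.
Qed.

Lemma window_term_le (al be t y : R) (Q : {poly R}) : 0 < t -> t < 1 / 4 -> t < al -> be < 2 ->
  (forall y, 0 <= Q.[expR y]) ->
  (forall y, y <= 3 -> Q.[expR y] <= (1 - t) ^- 4) ->
  (forall y, y <= 3 -> (y <= al - t) || (be + t <= y) -> Q.[expR y] <= t ^+ 2 * (1 - t) ^- 4) ->
  Q.[expR y] * Num.sqrt (1 + t - y ^+ 2) ^+ m <=
   (1 - t) ^- 4 * Num.sqrt (1 + t - (al - t) ^+ 2) ^+ m * ((al - t <= y) && (y <= be + t))%:R +
   t ^+ 2 * (1 - t) ^- 4 * 2 ^+ m * ((- 2 <= y) && (y <= 2))%:R.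
Proof.
move=> t0 t4 tal be2 Q0 Q2 Q3.
have k0 : 0 < (1 - t) ^- 4 by rewrite invr_gt0 exprn_gt0 //; lra.
set s := Num.sqrt (1 + t - y ^+ 2).
have [y1|y1] := boolP ((al - t <= y) && (y <= be + t)).
  case/andP: y1 => y1 y2; rewrite mulr1.
  apply: (@le_trans _ _ ((1 - t) ^- 4 * Num.sqrt (1 + t - (al - t) ^+ 2) ^+ m)).
    rewrite ler_pM ?Q0 ?exprn_ge0 ?sqrtr_ge0 //; first by apply: Q2; lra.
    rewrite lerXn2r ?nnegrE ?sqrtr_ge0 // ler_wsqrtr // lerD2l lerN2.
    by rewrite lerXn2r ?nnegrE //; lra.
  rewrite lerDl; apply: mulr_ge0 => //; apply: mulr_ge0; last exact: exprn_ge0.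
  by apply: mulr_ge0; [exact: sqr_ge0|exact: ltW].
rewrite mulr0 add0r.
have [y2|y2] := boolP ((- 2 <= y) && (y <= 2)).
  case/andP: y2 => y2 y3; rewrite mulr1 ler_pM ?Q0 ?exprn_ge0 ?sqrtr_ge0 //.
    apply: Q3; first by lra.
    move: y1; rewrite negb_and -!ltNge => /orP[] yy; apply/orP; [left|right]; lra.
  rewrite lerXn2r ?nnegrE ?sqrtr_ge0 // -[leRHS]ger0_norm // -sqrtr_sqr ler_wsqrtr //.
  rewrite (_ : 2 ^+ 2 = 4); last by ring.
  by clear -t4; have := sqr_ge0 y; lra.
(* Beyond 2 the radicand is negative, its root is 0 by convention, and m > 0; the size of Q there is
   irrelevant. *)
rewrite mulr0; have -> : s = 0.
  apply/eqP; rewrite sqrtr_eq0.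
  have : 4 <= y ^+ 2.
    move: y2; rewrite negb_and -!ltNge => /orP[] yy; rewrite expr2; nra.
  lra.
by rewrite expr0n gtn_eqF // mulr0.
Qed.

(** As al > 0, the widest section of the slab is the one at height al, so the main term bounds the
    volume of the slab from above. *)
Lemma slab_box (al be e : R) : 0 < al -> al <= be -> be < 2 -> 0 < e ->
  exists B d : R, [/\ 0 < B, 0 < d & forall h M (u th : 'I_n -> R),
    0 < h -> h <= 1 -> \sum_i u i ^+ 2 = 1 -> (forall i, `|th i| <= 1) ->
    B <= M%:R * h -> M%:R * h ^+ 2 <= d ->
    h ^+ n * (\sum_(z : {ffun 'I_n -> 'I_(M.*2)})
      [&& grid_normsq h th z <= 1, al <= grid_dot h u th z & grid_dot h u th z <= be]%:R)
    <= V * Num.sqrt (1 - al ^+ 2) ^+ m * (be - al) + e].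
Proof.
move=> al0 albe be2 e0.
have e40 : 0 < e / 4 by rewrite divr_gt0.
have V0 := ball_volume_gt0 R m.
have [t [t0 t4 tal] Ht] := slab_volume_perturb be al0 e40.
have [Q [Q0 Q1 Q2 Q3]] := exists_window albe be2 t0 t4.
have [C C0 [B1 [d1 [B10 d10 HC]]]] := gauss_poly_grid_bounded Q.
move: Ht; set Psi := V * _; set Psi0 := V * _ * _ => Ht.
have k0 : 0 < (1 - t) ^- 4 by rewrite invr_gt0 exprn_gt0 //; lra.
have Psi_ge0 : 0 <= Psi.
  rewrite mulr_ge0 ?(ltW V0) // addr_ge0 //
    !mulr_ge0 ?sqr_ge0 ?exprn_ge0 ?sqrtr_ge0 ?(ltW k0) //; lra.
pose D := Num.sqrt pi ^+ m * C.
have D0 : 0 <= D by rewrite mulr_ge0 ?exprn_ge0 ?sqrtr_ge0 // ltW.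
(* The accuracy of the radial step comes last: [D] depends on Q, hence on t. *)
have [e1 [e10 e1h e1e]] : exists e1, [/\ 0 < e1, e1 <= 1 / 2 & 2 * e1 * (Psi + D + 1) <= e / 4].
  have K0 : 0 < Psi + D + 1 by lra.
  exists (Num.min (1 / 2) (e / 8 / (Psi + D + 1))); split.
  - by rewrite lt_min !divr_gt0.
  - by rewrite ge_min lexx.
  - rewrite -ler_pdivlMr // (@le_trans _ _ (2 * (e / 8 / (Psi + D + 1)))) //.
      by rewrite ler_pM2l // ge_min lexx orbT.
    by rewrite le_eqVlt; apply/orP; left; apply/eqP; field; rewrite gt_eqF.
have [a [N [a0 N0 A1 _ A3]]] : exists a N, [/\ (0 < a)%N, (0 < N)%N,
    forall w, 0 <= w -> w <= 1 -> 1 - e1 <= (step_poly R a N).[expR (- w)],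
    forall w, 1 + t <= w -> (step_poly R a N).[expR (- w)] <= e1 &
    forall w, 1 + t <= w -> a%:R * N%:R * expR (- w) ^+ a <= e1 * expR (- w)].
  by apply: exists_step_poly => //; lra.
pose g := step_poly R a N.
have g0 : g`_0 = 0.
  by rewrite -horner_coef0 horner_step_poly expr0n gtn_eqF // subr0 expr1n subrr.
have [B2 [d2 [B20 d20 HF]]] := @poly_box R m g Q g0 _ e40.
(* The bound t B1 forces h <= t, because B1 h <= M h^2 <= t B1. *)
exists (Num.max B1 B2), (Num.min (Num.min d1 d2) (t * B1)); split.
- by rewrite lt_max B10.
- by rewrite !lt_min d10 d20 mulr_gt0.
move=> h M u th h0 h1 u1 th1; rewrite ge_max !le_min => /andP[b1 b2] /andP[/andP[c1 c2] c3].
have ht : h <= t.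
  rewrite -(ler_pM2r B10); apply: le_trans c3.
  by rewrite expr2 mulrA mulrC ler_pM2r.
have {HC} HC := HC h M h0 b1 c1.
have {HF} HF := HF h M u th h0 h1 u1 th1 b2 c2.
have hn0 : 0 < h ^+ n by rewrite exprn_gt0.
have e1' : 0 < 1 - e1 by lra.
have W0 (z : {ffun 'I_n -> 'I_(M.*2)}) : 0 <= grid_normsq h th z.
  by rewrite sumr_ge0 // => i _; rewrite sqr_ge0.
have gu (z : {ffun 'I_n -> 'I_(M.*2)}) := step_poly_ge0_le1 a N (expRN_unit (W0 z)).
apply: (@le_trans _ _ ((1 - e1)^-1 * (h ^+ n * (\sum_(z : {ffun 'I_n ->
  'I_(M.*2)}) g.[expR (- grid_normsq h th z)] * Q.[expR (grid_dot h u th z)])))).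
  rewrite mulrCA ler_pM2l // mulr_sumr; apply: ler_sum => z _.
  case: (boolP [&& _, _ & _]) => [/and3P[z1 z2 z3]|_].
    rewrite mulrA -[leLHS]mulr1 ler_pM //; last exact: Q1.
    by rewrite mulrC ler_pdivlMr // mul1r A1.
  by rewrite !mulr_ge0 ?Q0 ?invr_ge0 ?(ltW e1') //; have /andP[] := gu z.
set S2 := h * \sum_(j < M.*2) _ in HF.
have HS : S2 <= Psi + e1 * D.
  apply: (@le_trans _ _ (V * ((1 - t) ^- 4 * Num.sqrt (1 + t - (al - t) ^+ 2) ^+ m *
       (h * \sum_(j < M.*2) ((al - t <= grid h M j) && (grid h M j <= be + t))%:R) +
       t ^+ 2 * (1 - t) ^- 4 * 2 ^+ m * (h *
         \sum_(j < M.*2) ((- 2 <= grid h M j) && (grid h M j <= 2))%:R)) +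
       e1 * Num.sqrt pi ^+ m * (h * \sum_(j < M.*2) Q.[expR (grid h M j)] *
         expR (- grid h M j ^+ 2)))).
    rewrite /S2 ![_ * (h * _)]mulrCA -mulrDr [V * _]mulrCA -mulrDr ler_pM2l //.
    rewrite !mulr_sumr -big_split /= mulr_sumr -big_split /=.
    apply: ler_sum => j _; set y := grid h M j.
    apply: le_trans (ler_wpM2l (Q0 y) (radial_profile_step_le y m0 a0 N0 (ltW e10) A3)) _.
    rewrite mulrDr; apply: lerD; last by rewrite le_eqVlt; apply/orP; left; apply/eqP; ring.
    rewrite mulrCA ler_pM2l //.
    exact: window_term_le.
  have G1 := @grid_count R h M (al - t) (be + t) h0.
  have {}G1 : h * \sum_(j < M.*2) ((al - t <= grid h M j) && (grid h M j <= be +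
    t))%:R <= be - al + 3 * t.
    by apply: le_trans (G1 _) _; lra.
  have G2 : h * \sum_(j < M.*2) ((- 2 <= grid h M j) && (grid h M j <= 2))%:R <= 5.
    by apply: le_trans (@grid_count R h M (- 2) 2 h0 _) _; lra.
  apply: lerD.
    rewrite ler_pM2l //; apply: lerD.
      by rewrite ler_wpM2l // mulr_ge0 ?exprn_ge0 ?sqrtr_ge0 // ltW.
    by rewrite ler_wpM2l // !mulr_ge0 ?sqr_ge0 ?exprn_ge0 // ltW.
  by rewrite /D -mulrA ler_pM2l // ler_wpM2l // exprn_ge0 // sqrtr_ge0.
have X1 := ler_norm (h ^+ n * (\sum_(z : {ffun 'I_n ->
  'I_(M.*2)}) g.[expR (- grid_normsq h th z)] * Q.[expR (grid_dot h u th z)]) - S2).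
rewrite mulrC ler_pdivrMr //.
apply: (@le_trans _ _ (Psi + e1 * D + e / 4)).
  by rewrite -lerBlDl; apply: le_trans (le_trans X1 HF); rewrite lerD2l lerN2.
apply: (@le_trans _ _ ((Psi + 3 * e / 4) * (1 - e1))); last first.
  by rewrite ler_wpM2r ?(ltW e1') // ; move: Ht; lra.
have h1e : e1 * e <= e / 2 by rewrite mulrC ler_pM2l //; lra.
move: e1e h1e; rewrite !mulrDr !mulrDl; lra.
Qed.

Lemma slab_count (al be e : R) : 0 < al -> al <= be -> be < 2 -> 0 < e ->
  exists2 h0 : R, 0 < h0 & forall h (u th : 'I_n -> R) (l : seq 'rV[int]_n),
    0 < h -> h <= h0 -> \sum_i u i ^+ 2 = 1 -> (forall i, `|th i| <= 1) -> uniq l ->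
    (forall z, z \in l -> [/\ \sum_i (h * ((z 0 i)%:~R + th i)) ^+ 2 <= 1,
       al <= \sum_i u i * (h * ((z 0 i)%:~R + th i)) &
       \sum_i u i * (h * ((z 0 i)%:~R + th i)) <= be]) ->
    h ^+ n * (size l)%:R <= V * Num.sqrt (1 - al ^+ 2) ^+ m * (be - al) + e.
Proof.
move=> al0 albe be2 e0.
have [B [d [B0 d0 H]]] := slab_box al0 albe be2 e0.
exists (Num.min (Num.min 1 (d / 4)) (d / (B + 1))).
  by rewrite !lt_min ltr01 !divr_gt0 // addr_gt0.
move=> h u th l h0; rewrite !le_min => /andP[/andP[h1 hd] hB] u1 th1 ul Hl.
have h20 : 0 < h ^+ 2 by rewrite exprn_gt0.
(* M h^2 stays just below d, so that M h is about d / h, large for small h. *)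
have [M M1 M2] : exists2 M : nat, M%:R <= d / h ^+ 2 & d / h ^+ 2 < M%:R + 1.
  exists (Num.truncn (d / h ^+ 2)); first by rewrite truncn_le // divr_ge0 // ltW.
  by rewrite natr1 truncnS_gt.
have dh : d / h ^+ 2 * h ^+ 2 = d by rewrite divfK // gt_eqF.
have c1 : M%:R * h ^+ 2 <= d by rewrite -ler_pdivlMr.
have c2 : d < M%:R * h ^+ 2 + h ^+ 2.
  by rewrite -[X in _ + X]mul1r -mulrDl -ltr_pdivrMr.
have b1 : B <= M%:R * h.
  rewrite -(ler_pM2r h0) -mulrA -expr2.
  have : h * (B + 1) <= d by rewrite -ler_pdivlMr // addr_gt0.
  have : h ^+ 2 <= h by rewrite expr2 ler_piMr // ltW.
  lra.
(* The box has to contain the unit ball in spite of the shift: |z_i| <= 1/h + |th_i| < M. *)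
have M3 : 1 / h + 1 < M%:R.
  have k1 : h ^+ 2 <= h by rewrite expr2 ler_piMr // ltW.
  have k2 : 1 / h * h ^+ 2 = h by field; rewrite gt_eqF.
  by rewrite -(ltr_pM2r h20) mulrDl k2 mul1r; lra.
have M0 : (0 < M.*2)%N.
  by rewrite double_gt0 -(ltr0n R); apply: lt_trans M3; rewrite addr_gt0 // divr_gt0.
(* The default index of [insubd] is never reached on [l], by [bnd]. *)
pose phi (z : 'rV[int]_n) : {ffun 'I_n ->
  'I_(M.*2)} := [ffun i => insubd (Ordinal M0) (absz (z 0 i + M%:Z))].
have bnd z i : z \in l -> - M%:Z < z 0 i < M%:Z.
  move=> /Hl[z1 _ _].
  have : (h * ((z 0 i)%:~R + th i)) ^+ 2 <= 1.
    by apply: le_trans z1; rewrite (bigD1 i) //= lerDl sumr_ge0 // => j _; rewrite sqr_ge0.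
  rewrite -[X in _ <= X](expr1n _ 2) -[leLHS]real_normK ?num_real //.
  rewrite ler_pXn2r ?nnegrE // normrM (ger0_norm (ltW h0)) => z2.
  have z3 : `|(z 0 i)%:~R + th i| <= 1 / h by rewrite ler_pdivlMr // mulrC.
  have z4 : `|(z 0 i)%:~R| < M%:R :> R.
    rewrite -[X in `|X|](addrK (th i)); apply: le_lt_trans (ler_normB _ _) _.
    by apply: le_lt_trans M3; apply: lerD.
  by move: z4; rewrite ltr_norml (_ : M%:R = (M%:Z)%:~R :> R) // -mulrNz !ltr_int.
have phiE z i : z \in l -> (phi z i)%:R - M%:R = (z 0 i)%:~R :> R.
  move=> zl; have /andP[k1 k2] := bnd _ i zl.
  have k3 : (absz (z 0 i + M%:Z)%R < M.*2)%N by clear -k1 k2; move: (z 0 i) k1 k2 => x k1 k2;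
    rewrite -muln2; lia.
  have k4 : (absz (z 0 i + M%:Z))%:Z = z 0 i + M%:Z by clear -k1 k2;
    move: (z 0 i) k1 k2 => x k1 k2; rewrite gez0_abs //; lia.
  rewrite ffunE val_insubd k3 -[LHS]/((absz (z 0 i + M%:Z))%:Z%:~R - M%:Z%:~R) k4.
  by rewrite rmorphD /= addrK.
have phi_inj : {in l &, injective phi}.
  move=> z z' zl zl' E; apply/rowP => i; apply/eqP; rewrite -(eqr_int R).
  by rewrite -!phiE // E.
have := H h M u th h0 h1 u1 th1 b1 c1; apply: le_trans.
rewrite ler_pM2l ?exprn_gt0 //.
have ul' : uniq [seq phi z | z <- l] by rewrite map_inj_in_uniq.
apply: (@le_trans _ _ (\sum_(x <- [seq phi z | z <- l]) [&& grid_normsq h th x <= 1, al <=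
  grid_dot h u th x & grid_dot h u th x <= be]%:R)).
  rewrite big_map big_seq (eq_bigr (fun=> 1)) => [|z zl].
    by rewrite -big_seq big_const_seq count_predT iter_addr_0.
  have [z1 z2 z3] := Hl z zl.
  have E i : gridv h th (phi z) i = h * ((z 0 i)%:~R + th i) by rewrite /gridv phiE.
  rewrite /grid_normsq /grid_dot.
  under eq_bigr do rewrite E. under [in X in _ && (X && _)]eq_bigr do rewrite E.
  under [in X in _ && (_ && X)]eq_bigr do rewrite E.
  by rewrite z1 z2 z3.
rewrite big_uniq //= big_mkcond /=; apply: ler_sum => x _.
by case: ifP => // _; rewrite ler0n.
Qed.
End slab.

(** * Primitive residues *)

Section primitive_residues.
Local Open Scope nat_scope.

Lemma moebius_mul_prime (p l : nat) : prime p -> 0 < l -> coprime p l ->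
  moebius (p * l) = (- moebius l)%R.
Proof.
move=> pp l0 cpl.
have npl : p \notin primes l by rewrite mem_primes pp l0 /= -prime_coprime.
have Pl : perm_eq (primes (p * l)) (p :: primes l).
  apply: uniq_perm; rewrite ?primes_uniq //= ?npl ?primes_uniq //.
  by move=> q; rewrite in_cons (primesM q) ?(prime_gt0 pp) // (primes_prime pp) inE.
rewrite /moebius (perm_all _ Pl) (perm_size Pl) /=.
rewrite lognM ?(prime_gt0 pp) // logn_prime // eqxx logn_coprime // addn0 eqxx /=.
have -> : all (fun q => logn q (p * l) == 1) (primes l) = all (fun q => logn q l == 1) (primes l).
  apply: eq_in_all => q ql; rewrite lognM ?(prime_gt0 pp) // logn_prime //.
  have /negPf -> // : q != p by apply: contraNneq npl => <-.
by case: ifP; rewrite ?oppr0 // exprS mulN1r.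
Qed.

Lemma moebius_square_dvd (p l : nat) : prime p -> 0 < l -> p ^ 2 %| l -> moebius l = 0%R.
Proof.
move=> pp l0 p2; rewrite /moebius; case: ifP => // /allP/(_ p) H.
have : p \in primes l by rewrite mem_primes pp l0 (dvdn_trans _ p2) // dvdn_exp.
by move/H => /eqP; move: p2; rewrite pfactor_dvdn // => /[swap] ->.
Qed.

(** For a prime p dividing g, the divisors divisible by p^2 contribute 0, and l -> p l pairs the
    divisors prime to p with the remaining ones, with opposite signs. *)
Lemma sum_moebius (g : nat) : 0 < g -> (\sum_(l <- divisors g) moebius l = (g == 1%N)%:R)%R.
Proof.
move=> g0; have [->|g1] := eqVneq g 1.
  by rewrite (_ : divisors 1 = [:: 1]) // big_seq1.
have g2 : 1 < g by lia.
set p := pdiv g; have pp : prime p by exact: pdiv_prime.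
have pg : p %| g by exact: pdiv_dvd.
rewrite (bigID (fun l => p %| l)) /= -[RHS](addNr (\sum_(l <- divisors g | ~~ (p %| l)%N)
  moebius l)%R).
congr (_ + _)%R.
rewrite (bigID (fun l => p ^ 2 %| l)) /= big1_seq ?add0r; last first.
  move=> l /andP[/andP[_ p2]]; rewrite -dvdn_divisors // => lg.
  by rewrite (moebius_square_dvd pp) // (dvdn_gt0 g0).
rewrite -sumrN -big_filter -[RHS]big_filter.
rewrite (perm_big [seq p * l | l <- [seq l <- divisors g | ~~ (p %| l)]]) /=; last first.
  apply: uniq_perm.
  - by rewrite filter_uniq // divisors_uniq.
  - rewrite map_inj_uniq ?filter_uniq ?divisors_uniq //.
    by move=> a b /eqP; rewrite eqn_pmul2l ?(prime_gt0 pp) // => /eqP.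
  move=> l; rewrite mem_filter; apply/idP/mapP.
    rewrite -dvdn_divisors // => /andP[/andP[/dvdnP[k ->] np2] kg].
    exists k; last by rewrite mulnC.
    rewrite mem_filter -dvdn_divisors // (dvdn_trans _ kg) ?dvdn_mulr // andbT.
    by apply: contra np2 => /dvdnP[j ->]; rewrite -mulnA mulnn dvdn_mull.
  case=> k; rewrite mem_filter -!dvdn_divisors // => /andP[npk kg] ->.
  rewrite dvdn_mulr // expnS expn1 dvdn_pmul2l ?(prime_gt0 pp) // npk /=.
  by rewrite Gauss_dvd ?prime_coprime // pg.
rewrite big_map big_seq [RHS]big_seq; apply: eq_bigr => l.
rewrite mem_filter -dvdn_divisors // => /andP[npl lg].
by rewrite moebius_mul_prime ?prime_coprime // (dvdn_gt0 g0).
Qed.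

(* Residues of the last m coordinates of a vector orthogonal to s mod k: as s_0 = 1, they determine
   the first one and have the same gcd with k as the whole vector. *)
Definition prim_residues (m k : nat) : {set {ffun 'I_m -> 'I_k}} :=
  [set a : {ffun 'I_m -> 'I_k} | [forall d : 'I_k.+1, (1 < d) ==> ~~ ((d %| k) && [forall i, d
    %| a i])]].

Lemma card_multiples (m k l : nat) : 0 < k -> l %| k ->
  #|[set a : {ffun 'I_m -> 'I_k} | [forall i, l %| a i]]%SET| = (k %/ l) ^ m.
Proof.
move=> k0 lk; have l0 : 0 < l := dvdn_gt0 k0 lk.
pose A : pred 'I_k := [pred x : 'I_k | l %| x].
have -> : #|[set a : {ffun 'I_m ->
  'I_k} | [forall i, l %| a i]]%SET| = #|ffun_on A : {pred {ffun 'I_m -> 'I_k}}|.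
  apply: eq_card => a; apply/idP/idP => [|/ffun_onP H]; rewrite inE.
    by move/forallP => H; apply/ffun_onP => i; exact: H.
  by apply/forallP => i; exact: H.
rewrite card_ffun_on card_ord; congr (_ ^ _).
have lt (j : 'I_(k %/ l)) : l * j < k.
  by rewrite -{2}(divnK lk) mulnC ltn_pmul2r.
pose f (j : 'I_(k %/ l)) : 'I_k := Ordinal (lt j).
have fi : injective f.
  by move=> i j /(congr1 val) /= /eqP; rewrite eqn_pmul2l // => /eqP /val_inj.
rewrite -[RHS]card_ord -(card_imset _ fi); apply: eq_card => x.
rewrite inE /=; apply/idP/imsetP => [lx|[j _ ->]]; last by rewrite /f /= dvdn_mulr.
have jl : x %/ l < k %/ l by rewrite ltn_divLR // divnK.
by exists (Ordinal jl) => //; apply: val_inj; rewrite /= mulnC divnK.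
Qed.

(** The count is Jordan's totient J_m(k), obtained by Moebius summation over the gcd of k and all
    entries; starting the iterated gcd [gg] at k includes k itself. *)
Lemma card_prim_residues (m k : nat) : 0 < k ->
  (#|prim_residues m k|%:Z = \sum_(l <- divisors k) moebius l * ((k %/ l) ^ m)%N%:Z)%R.
Proof.
move=> k0.
pose gg (a : {ffun 'I_m -> 'I_k}) := \big[gcdn/k]_i (a i : nat).
have ggP a d : d %| gg a = (d %| k) && [forall i, d %| a i].
  rewrite /gg; apply/idP/andP.
    move=> H; split.
      apply: dvdn_trans H _; elim/big_rec: _ => // i x _ xk.
      exact: dvdn_trans (dvdn_gcdr _ _) xk.
    apply/forallP => i; apply: dvdn_trans H _.
    by rewrite (bigD1 i) //= dvdn_gcdl.
  move=> [dk /forallP H]; elim/big_rec: _ => // i x _ dx.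
  by rewrite dvdn_gcd H dx.
have gg0 a : 0 < gg a.
  have : gg a %| k by have := ggP a (gg a); rewrite dvdnn => /esym/andP[].
  exact: dvdn_gt0.
have pE a : (a \in prim_residues m k) = (gg a == 1).
  rewrite inE; apply/forallP/eqP => [H|g1 d].
    apply/eqP; rewrite eqn_leq gg0 andbT leqNgt; apply/negP => g1.
    have gk : gg a %| k by have := ggP a (gg a); rewrite dvdnn => /esym/andP[].
    have lt : gg a < k.+1 by rewrite ltnS dvdn_leq.
    by have := H (Ordinal lt); rewrite /= g1 -ggP dvdnn.
  by apply/implyP => d1; rewrite -ggP g1 dvdn1 gtn_eqF.
transitivity (\sum_(a : {ffun 'I_m -> 'I_k}) (gg a == 1%N)%:Z)%R.
  rewrite -[LHS]natz -sum1_card natr_sum big_mkcond /=; apply: eq_bigr => a _.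
  by rewrite pE; case: eqP.
transitivity (\sum_(a : {ffun 'I_m ->
  'I_k}) \sum_(l <- divisors k | [forall i, (l %| a i)%N]) moebius l)%R.
  apply: eq_bigr => a _; rewrite -natz -(sum_moebius (gg0 a)) -[RHS]big_filter.
  apply: perm_big; apply: uniq_perm; rewrite ?filter_uniq ?divisors_uniq //.
  by move=> l; rewrite mem_filter -!dvdn_divisors // ggP andbC.
under eq_bigr do rewrite big_mkcond /=.
rewrite exchange_big /= big_seq [RHS]big_seq; apply: eq_bigr => l; rewrite -dvdn_divisors // => lk.
transitivity (\sum_(a in [set a : {ffun 'I_m -> 'I_k} | [forall i, (l %| a i)%N]]%SET) moebius l)%R.
  by rewrite [RHS]big_mkcond /=; apply: eq_bigr => a _; rewrite inE.
by rewrite sumr_const card_multiples // -mulr_natr natz.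
Qed.

Lemma card_prim_residuesE (R : realType) (m k : nat) : 0 < k ->
  (#|prim_residues m k|%:R = k%:R ^+ m *
    \sum_(l <- divisors k) (moebius l)%:~R / l%:R ^+ m :> R)%R.
Proof.
move=> k0; rewrite -[LHS]/((#|prim_residues m k|%:Z)%:~R)%R card_prim_residues //.
rewrite rmorph_sum /= mulr_sumr big_seq [RHS]big_seq; apply: eq_bigr => l.
rewrite -dvdn_divisors // => lk; have l0 : 0 < l := dvdn_gt0 k0 lk.
rewrite rmorphM /= mulrCA; congr (_ * _)%R.
rewrite -[LHS]/(((k %/ l) ^ m)%N%:R)%R -{2}(divnK lk) natrX natrM exprMn mulfK //.
by rewrite expf_neq0 // pnatr_eq0 -lt0n.
Qed.
End primitive_residues.

(** * Witnesses of non-extendability *)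

Lemma lattice_min_exists (d : nat) (L : set 'rV[int]_d) (mu : nat) :
  (exists2 z, L z & z != 0) -> (forall z, L z -> z != 0 -> mu%:Z <= sqnorm z) ->
  exists2 a, is_lattice_min L a & mu%:Z <= a.
Proof.
move=> [z0 Lz0 z00] Hmu.
have sq0 (z : 'rV[int]_d) : 0 <= sqnorm z by apply: sumr_ge0 => i _; exact: sqr_ge0.
pose p (j : nat) := `[< exists z, [/\ L z, z != 0 & sqnorm z = j%:Z] >].
have exp : exists j, p j.
  by exists (absz (sqnorm z0)); apply/asboolP; exists z0; rewrite gez0_abs.
case: (ex_minnP exp) => j /asboolP[z [Lz zn0 zj]] minj.
exists j%:Z; last by rewrite -zj; exact: Hmu.
split; first by exists z.
move=> z' Lz' z'0; rewrite -[sqnorm z']gez0_abs // lez_nat; apply: minj.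
by apply/asboolP; exists z'; rewrite gez0_abs.
Qed.

(** Dividing z and k by a common factor leaves t unchanged and only shortens the vector, so descent
    on k ends at a primitive pair. *)
Lemma primitive_witness (m mu : nat) (s : nat -> nat) (t k : nat) (z : 'rV[int]_m.+1) :
  (0 < k)%N -> \sum_(i < m.+1) (s i)%:Z * z 0 i = (k * t)%:Z -> sqnorm z + k%:Z ^+ 2 < mu%:Z ->
  exists (z' : 'rV[int]_m.+1) k', [/\ (0 < k')%N, \sum_(i < m.+1) (s i)%:Z * z' 0 i = (k' * t)%:Z,
    sqnorm z' + k'%:Z ^+ 2 < mu%:Z &
    forall d, (1 < d)%N -> (d %| k')%N -> ~ forall i, (d%:Z %| z' 0%R i)%Z].
Proof.
elim/ltn_ind: k z => k IH z k0 Ez Nz.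
have [[d d1 [dk dz]]|H] := pselect (exists2 d, (1 < d)%N &
  (d %| k)%N /\ forall i, (d%:Z %| z 0%R i)%Z); last first.
  exists z, k; split => // d d1 dk dz; apply: H; by exists d.
have d0 : (0 < d)%N by apply: ltn_trans d1.
have dz0 : d%:Z != 0 by rewrite gt_eqF // ltz_nat.
pose w : 'rV[int]_m.+1 := \row_i (z 0%R i %/ d)%Z.
have zw i : z 0 i = d%:Z * w 0 i by rewrite mxE mulrC divzK.
have kE : k = (d * (k %/ d))%N by rewrite mulnC divnK.
have k'0 : (0 < k %/ d)%N by rewrite divn_gt0 // dvdn_leq.
have d2 : 1 <= d%:Z ^+ 2 by rewrite exprn_ege1 // lez_nat.
apply: (IH (k %/ d)%N _ w) => //.
- by rewrite ltn_Pdiv.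
- apply: (mulfI dz0); rewrite mulr_sumr -PoszM mulnA -kE -Ez.
  by apply: eq_bigr => i _; rewrite zw; ring.
apply: le_lt_trans Nz; apply: lerD.
  by apply: ler_sum => i _; rewrite zw exprMn ler_peMl // sqr_ge0.
by rewrite [in leRHS]kE PoszM exprMn ler_peMl // sqr_ge0.
Qed.

Lemma nonextension_witness (m mu : nat) (s : seq nat) (t : nat) :
  size s = m.+1 -> (0 < m)%N -> mu_sequence mu s -> (0 < t)%N -> ~ mu_sequence mu (rcons s t) ->
  exists (z : 'rV[int]_m.+1) k, [/\ (0 < k)%N, \sum_(i < m.+1) (nth 0%N s i)%:Z * z 0 i = (k *
    t)%:Z,
    sqnorm z + k%:Z ^+ 2 < mu%:Z &
    forall d, (1 < d)%N -> (d %| k)%N -> ~ forall i, (d%:Z %| z 0%R i)%Z].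
Proof.
move=> szs m0 [s0 spos slat] t0 Hn; apply: contrapT => Hw; apply: Hn.
have nthl i : (i < m.+1)%N -> nth 0%N (rcons s t) i = nth 0%N s i.
  by move=> im; rewrite nth_rcons szs im.
have nthr : nth 0%N (rcons s t) m.+1 = t by rewrite nth_rcons szs ltnn eqxx.
split.
- by rewrite nthl.
- move=> k; rewrite size_rcons szs ltnS leq_eqVlt => /orP[/eqP->|km]; first by rewrite nthr.
  by rewrite nthl // spos // szs.
move=> j; rewrite size_rcons szs => /andP[j0]; rewrite ltnS leq_eqVlt => /orP[/eqP->|jm];
  last first.
  have -> : orth_lattice (nth 0%N (rcons s t)) j = orth_lattice (nth 0%N s) j.
    rewrite /orth_lattice; apply/funext => z; apply/propext => /=.
    suff -> : \sum_(k < j.+1) (nth 0%N (rcons s t) k)%:Z *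
      z 0 k = \sum_(k < j.+1) (nth 0%N s k)%:Z * z 0 k by [].
    by apply: eq_bigr => i _; rewrite nthl // (leq_trans (ltn_ord i)).
  by apply: slat; rewrite j0 szs.
apply: lattice_min_exists.
  (* Since s_0 = 1, the vector (t, 0, ..., 0, -1) is orthogonal to the extended sequence: the
     lattice is nonzero and its minimum exists. *)
  exists (\row_i (if i == ord0 then t%:Z else if i == ord_max then - 1 else 0)).
    rewrite /orth_lattice /= big_ord_recr big_ord_recl /= !mxE /= nthl // s0 nthr.
    rewrite big1 ?addr0 => [|i _]; last first.
      rewrite mxE; case: eqP => [/(congr1 val) //|_]; case: eqP => [/(congr1 val) /= /eqP|_];
        last by rewrite mulr0.
      by rewrite /bump /= add1n eqSS ltn_eqF // ltn_ord.
    by rewrite eqxx mulrN mulr1 mul1r subrr.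
  apply/eqP => /rowP/(_ ord0); rewrite !mxE eqxx => -[] tz; by rewrite tz in t0.
move=> z Lz zn0; rewrite leNgt; apply/negP => zmu.
pose z' : 'rV[int]_m.+1 := \row_i z 0 (widen_ord (leqnSn _) i).
have Nz : sqnorm z = sqnorm z' + z 0 ord_max ^+ 2.
  by rewrite /sqnorm big_ord_recr /=; congr (_ + _); apply: eq_bigr => i _; rewrite mxE.
have Ez : \sum_(i < m.+1) (nth 0%N s i)%:Z * z' 0 i + t%:Z * z 0 ord_max = 0.
  move: Lz; rewrite /orth_lattice /= big_ord_recr /= nthr => Lz0; rewrite -[RHS]Lz0; congr (_ + _).
  by apply: eq_bigr => i _; rewrite mxE nthl.
(* A short vector with last coordinate 0 would lie in the lattice of s, whose minimum is at least
   mu. Otherwise the sign e turns the last coordinate into -k with k > 0. *)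
have [zm|zm] := eqVneq (z 0 ord_max) 0.
  have hm : (0 < m < size s)%N by rewrite m0 szs ltnS leqnn.
  have [a [_ amin] mua] := slat m hm.
  move: Ez Nz; rewrite zm mulr0 addr0 expr0n addr0 => Ez Nz.
  have z'0 : z' != 0.
    apply: contra_neq zn0 => z'0; apply/rowP => i; rewrite mxE.
    have [im|im] := ltnP i m.+1.
      move/rowP/(_ (Ordinal im)) : z'0; rewrite !mxE => <-; congr (z 0 _); exact: val_inj.
    rewrite -zm; congr (z 0 _); apply: val_inj => /=; apply/eqP; rewrite eqn_leq im andbT -ltnS;
      exact: ltn_ord.
  have := amin z' Ez z'0; rewrite -Nz => h.
  by move: (lt_le_trans zmu (le_trans mua h)); rewrite ltxx.
pose e : int := - Num.sg (z 0 ord_max).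
have e2 : e ^+ 2 = 1 by rewrite /e sqrrN sqr_sg zm.
apply: Hw; apply: (@primitive_witness m mu _ t (absz (z 0 ord_max)) (e *: z')).
- by rewrite absz_gt0.
- rewrite PoszM abszE -[`|_|]mulr1.
  have -> : \sum_(i < m.+1) (nth 0%N s i)%:Z * (e *: z') 0 i = e *
    \sum_(i < m.+1) (nth 0%N s i)%:Z * z' 0 i.
    by rewrite mulr_sumr; apply: eq_bigr => i _; rewrite !mxE mulrCA.
  have -> : \sum_(i < m.+1) (nth 0%N s i)%:Z * z' 0 i = - (t%:Z * z 0 ord_max).
    by apply/eqP; rewrite -addr_eq0 Ez.
  rewrite mulr1 normrEsg /e; ring.
- rewrite abszE real_normK ?num_real //.
  have -> : sqnorm (e *: z') = sqnorm z'.
    by apply: eq_bigr => i _; rewrite mxE exprMn e2 mul1r.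
  by rewrite -Nz.
Qed.

Lemma bessel_unit (R : realType) (n : nat) (u x : 'I_n -> R) : \sum_i u i ^+ 2 = 1 ->
  (\sum_i u i * x i) ^+ 2 <= \sum_i x i ^+ 2.
Proof.
move=> u1; set y := \sum_i u i * x i.
have E w : \sum_i (x i - w * u i) ^+ 2 =
    \sum_i x i ^+ 2 - 2 * w * (\sum_i u i * x i) + w ^+ 2 * \sum_i u i ^+ 2.
  rewrite !mulr_sumr -sumrB -big_split /=; apply: eq_bigr => i _; ring.
have : 0 <= \sum_i (x i - y * u i) ^+ 2 by apply: sumr_ge0 => i _; exact: sqr_ge0.
rewrite E u1 -/y; lra.
Qed.

(** Writing z = q (w + th), with th the common residue divided by q, turns the class into a shifted
    integer lattice, of mesh q / rho after scaling to the unit ball. Distinct t have distinct w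
    because s.z = q t. *)
Lemma residue_class_count (R : realType) (m : nat) (al be e : R) : (0 < m)%N ->
  0 < al -> al <= be -> be < 2 -> 0 < e ->
  exists2 rho0 : R, 0 < rho0 & forall (s : nat -> nat) (rho : R) (q : nat) (l : seq nat)
      (z : nat -> 'rV[int]_m.+1),
    let S := Num.sqrt (\sum_(i < m.+1) (s i)%:R ^+ 2) in
    s 0%N = 1%N -> (0 < q)%N -> rho0 * q%:R <= rho -> uniq l ->
    (forall t, t \in l -> [/\ \sum_(i < m.+1) (s i)%:Z * z t 0%R i = (q * t)%:Z,
       \sum_i ((z t 0%R i)%:~R) ^+ 2 <= rho ^+ 2,
       al <= q%:R * t%:R / (S * rho) & q%:R * t%:R / (S * rho) <= be]) ->
    (forall t t' i, t \in l -> t' \in l -> (z t 0%R i = z t' 0%R i %[mod q])%Z) ->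
    (size l)%:R <= (rho / q%:R) ^+ m.+1 *
       (ball_volume R m * Num.sqrt (1 - al ^+ 2) ^+ m * (be - al) + e).
Proof.
move=> m0 al0 albe be2 e0.
have [h0 h00 H] := slab_count m0 al0 albe be2 e0.
exists h0^-1; first by rewrite invr_gt0.
move=> s rho q l z S s0 q0 qrho ul Hl Hc.
have q0' : 0 < q%:R :> R by rewrite ltr0n.
have rho0 : 0 < rho by apply: lt_le_trans qrho; rewrite mulr_gt0 ?invr_gt0.
(* The shift th is read off the first element, so the empty list is treated apart. *)
case: l ul Hl Hc => [|t0 l'] ul Hl Hc.
  rewrite mulr_ge0 ?exprn_ge0 ?divr_ge0 ?(ltW rho0) // addr_ge0 ?(ltW e0) //.
  apply: mulr_ge0; last by rewrite subr_ge0.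
  by apply: mulr_ge0; [exact: ltW (ball_volume_gt0 R m)|rewrite exprn_ge0 // sqrtr_ge0].
set l := t0 :: l' in ul Hl Hc *.
have t0l : t0 \in l by rewrite mem_head.
have S2 : 1 <= \sum_(i < m.+1) (s i)%:R ^+ 2 :> R.
  rewrite big_ord_recl s0 expr1n lerDl sumr_ge0 // => i _; exact: sqr_ge0.
have S0 : 0 < S by rewrite sqrtr_gt0 (lt_le_trans _ S2).
pose u (i : 'I_m.+1) := (s i)%:R / S : R.
have u1 : \sum_i u i ^+ 2 = 1.
  under eq_bigr do rewrite /u expr_div_n.
  rewrite -mulr_suml sqr_sqrtr ?(le_trans _ S2) // divff // gt_eqF // (lt_le_trans _ S2) //.
pose th (i : 'I_m.+1) := ((z t0 0%R i %% q)%Z)%:~R / q%:R : R.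
have qz : (q : int) != 0 by rewrite gt_eqF // ltz_nat.
have th1 i : `|th i| <= 1.
  rewrite /th normrM normfV [`|q%:R|]ger0_norm ?ler0n // ler_pdivrMr // mul1r.
  rewrite ger0_norm ?ler0z ?modz_ge0 // -[q%:R]/((q%:Z)%:~R) ler_int ltW //.
  by rewrite ltz_pmod // ltz_nat.
pose w t : 'rV[int]_m.+1 := \row_i (z t 0%R i %/ q)%Z.
have zw t i : t \in l -> (z t 0%R i)%:~R = q%:R * ((w t 0%R i)%:~R + th i) :> R.
  move=> tl; rewrite /th mulrDr [_ * (_ / _)]mulrC divfK ?gt_eqF // mxE.
  rewrite {1}(divz_eq (z t 0%R i) q) (Hc t t0 i tl t0l) intrD intrM mulrC //.
have hq : 0 < q%:R / rho by rewrite divr_gt0.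
have hle : q%:R / rho <= h0 by rewrite ler_pdivrMr // mulrC -ler_pdivrMr // mulrC.
have xE t i : t \in l -> q%:R / rho * ((w t 0%R i)%:~R + th i) = (z t 0%R i)%:~R / rho.
  by move=> tl; rewrite (zw t i tl) mulrAC.
have uxE t : t \in l -> \sum_i u i * ((z t 0%R i)%:~R / rho) = q%:R * t%:R / (S * rho).
  move=> tl; have [E _ _ _] := Hl t tl.
  have -> : q%:R * t%:R = \sum_(i < m.+1) (s i)%:R * (z t 0%R i)%:~R :> R.
    rewrite -natrM -[LHS]/(((q * t)%N%:Z)%:~R) -E rmorph_sum /=.
    by apply: eq_bigr => i _; rewrite intrM.
  rewrite mulr_suml; apply: eq_bigr => i _; rewrite /u invfM; ring.
have ulw : uniq [seq w t | t <- l].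
  rewrite map_inj_in_uniq // => t t' tl t'l E.
  have [Et _ _ _] := Hl t tl; have [Et' _ _ _] := Hl t' t'l.
  have zz i : z t 0%R i = z t' 0%R i.
    by apply/eqP; rewrite -(eqr_int R) !zw // E.
  move: Et; under eq_bigr do rewrite zz.
  by rewrite Et' => -[] /eqP; rewrite eqn_pmul2l // => /eqP.
have := H _ u th [seq w t | t <- l] hq hle u1 th1 ulw; rewrite size_map => HH.
have : (q%:R / rho) ^+ m.+1 * (size l)%:R <= ball_volume R m * Num.sqrt (1 - al ^+ 2) ^+ m *
  (be - al) + e.
  apply: HH => _ /mapP[t tl ->]; have [_ N1 N2 N3] := Hl t tl.
  split.
  - under eq_bigr do rewrite xE // expr_div_n.
    by rewrite -mulr_suml ler_pdivrMr ?exprn_gt0 // mul1r.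
  - by under eq_bigr do rewrite xE //; rewrite uxE.
  - by under eq_bigr do rewrite xE //; rewrite uxE.
have -> : (rho / q%:R) ^+ m.+1 = ((q%:R / rho) ^+ m.+1)^-1 by rewrite -exprVn invfM invrK mulrC.
by move=> HB; rewrite mulrC ler_pdivlMr ?exprn_gt0 // mulrC.
Qed.

(** Each t is charged to the pair formed by k t and the residues of its witness mod k t; these are
    primitive, so bounds for single classes add up. *)
Lemma count_witnesses (R : realType) (m A : nat) (s : nat -> nat) (ts : seq nat)
    (z : nat -> 'rV[int]_m.+1) (k : nat -> nat) (N : nat -> R) :
  s 0%N = 1%N -> uniq ts ->
  (forall t, t \in ts -> [/\ (0 < k t)%N, (k t <= A)%N,
     \sum_(i < m.+1) (s i)%:Z * z t 0%R i = (k t * t)%:Z &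
     forall d, (1 < d)%N -> (d %| k t)%N -> ~ forall i, (d%:Z %| z t 0%R i)%Z]) ->
  (forall q, (0 < q <= A)%N -> forall l, uniq l -> {subset l <= ts} ->
     (forall t, t \in l -> k t = q) ->
     (forall t t' i, t \in l -> t' \in l -> (z t 0%R i = z t' 0%R i %[mod q])%Z) ->
     (size l)%:R <= N q) ->
  (size ts)%:R <= \sum_(q < A) #|prim_residues m q.+1|%:R * N q.+1.
Proof.
move=> s0 uts Hts HN.
pose res q t : {ffun 'I_m -> 'I_q.+1} := [ffun j => inord (absz (z t 0%R (lift ord0 j) %% q.+1)%Z)].
have resE q t j : (res q t j)%:Z = (z t 0%R (lift ord0 j) %% q.+1)%Z.
  rewrite ffunE inordK; last by rewrite -ltz_nat gez0_abs ?modz_ge0 // ltz_pmod.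
  by rewrite gez0_abs ?modz_ge0.
have cover t : t \in ts ->
    1 <= \sum_(q < A) \sum_(a in prim_residues m q.+1) ((k t == q.+1) && (res q t == a))%:R :> R.
  move=> tts; have [k0 kA Et Hd] := Hts t tts.
  have kt1 : ((k t).-1 < A)%N by lia.
  have ktE : k t = (k t).-1.+1 by lia.
  rewrite (bigD1 (Ordinal kt1)) //= (bigD1 (res (k t).-1 t)) /=; last first.
    rewrite inE; apply/forallP => d; apply/implyP => d1; apply/negP => /andP[dk /forallP Hj].
    move: (nat_of_ord d) d1 dk Hj => {}d d1 dk Hj; rewrite -ktE in dk.
    have Hj' j : (d%:Z %| z t 0%R (lift ord0 j))%Z.
      rewrite (divz_eq (z t 0%R (lift ord0 j)) (k t).-1.+1) rpredD //.
        by rewrite dvdz_mull // -ktE.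
      by rewrite -resE; exact: Hj.
    apply: (Hd d d1 dk) => i; have [j ->|->] := unliftP ord0 i; first exact: Hj'.
    have -> : z t 0%R ord0 = (k t * t)%:Z - \sum_(j < m) (s (lift ord0 j))%:Z *
      z t 0%R (lift ord0 j).
      by rewrite -Et big_ord_recl s0 mul1r addrK.
    rewrite rpredB //; first by rewrite PoszM dvdz_mulr.
    by apply: rpred_sum => j _; rewrite dvdz_mull.
  have -> : (k t == (k t).-1.+1) by apply/eqP.
  rewrite eqxx /= -addrA lerDl addr_ge0 // ?sumr_ge0 // => i _.
  by rewrite sumr_ge0.
apply: (@le_trans _ _ (\sum_(t <- ts) \sum_(q < A) \sum_(a in prim_residues m q.+1) ((k t ==
  q.+1) && (res q t == a))%:R)).
  rewrite -sum1_size natr_sum big_seq [leRHS]big_seq.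
  by apply: ler_sum => t tts; exact: cover.
rewrite exchange_big /=; apply: ler_sum => q _.
rewrite exchange_big /= -sum1_card natr_sum mulr_suml; apply: ler_sum => a _.
rewrite mul1r.
pose l := [seq t <- ts | (k t == q.+1) && (res q t == a)].
have -> : \sum_(t <- ts) ((k t == q.+1) && (res q t == a))%:R = (size l)%:R :> R.
  rewrite size_filter -sumn_count sumnE big_map natr_sum; apply: eq_bigr => t _; by case: (_ && _).
have lE t : t \in l -> [/\ t \in ts, k t = q.+1 & res q t = a].
  by rewrite mem_filter => /andP[/andP[/eqP ? /eqP ?] ?].
apply: HN.
- by rewrite ltn_ord.
- by rewrite filter_uniq.
- by move=> t /lE[].
- by move=> t /lE[].
move=> t t' i /lE[tts kt rt] /lE[t'ts kt' rt'].
have cj j : (z t 0%R (lift ord0 j) = z t' 0%R (lift ord0 j) %[mod q.+1])%Z.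
  by rewrite -!resE rt rt'.
have [j ->|->] := unliftP ord0 i; first exact: cj.
have [_ _ Et _] := Hts t tts; have [_ _ Et' _] := Hts t' t'ts.
rewrite kt in Et; rewrite kt' in Et'.
apply/eqP; rewrite eqz_mod_dvd.
have -> : z t 0%R ord0 - z t' 0%R ord0 = (q.+1 * t)%:Z - (q.+1 * t')%:Z -
    \sum_(j < m) (s (lift ord0 j))%:Z * (z t 0%R (lift ord0 j) - z t' 0%R (lift ord0 j)).
  rewrite -Et -Et' !big_ord_recl s0 !mul1r.
  have -> : \sum_(j < m) (s (lift ord0 j))%:Z * (z t 0 (lift ord0 j) - z t' 0 (lift ord0 j)) =
      \sum_(j < m) (s (lift ord0 j))%:Z * z t 0 (lift ord0 j) -
      \sum_(j < m) (s (lift ord0 j))%:Z * z t' 0 (lift ord0 j).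
    by rewrite -sumrB; apply: eq_bigr => j _; rewrite mulrBr.
  by ring.
rewrite rpredB //; first by rewrite rpredB // PoszM dvdz_mulr.
by apply: rpred_sum => j _; rewrite dvdz_mull // -eqz_mod_dvd; apply/eqP.
Qed.

(** * Counting bad extensions *)

Lemma powR_half (R : realType) (x : R) (m : nat) : 0 <= x -> x `^ (m%:R / 2) = Num.sqrt x ^+ m.
Proof. by move=> x0; rewrite mulrC powRrM powR_mulrn ?powR_ge0 // powR12_sqrt. Qed.

Lemma uniform_threshold (R : realType) (A : nat) (P : nat -> R -> Prop) :
  (forall q, (q < A)%N -> exists b, forall x, b <= x -> P q x) ->
  exists b, forall x q, b <= x -> (q < A)%N -> P q x.
Proof.
elim: A => [|A IH] H; first by exists 0.
have [b Hb] := IH (fun q qA => H q (ltnW qA)).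
have [b' Hb'] := H A (ltnSn A).
exists (Num.max b b') => x q; rewrite ge_max => /andP[h1 h2].
by rewrite ltnS leq_eqVlt => /orP[/eqP->|qA]; [exact: Hb'|exact: Hb].
Qed.

(** For k = 1 the heights will range over [c (1 - ze - ze^2), c (1 + ze^2)], of length ze times c (1
    + 2 ze). After division by ze the sum is continuous at 0, so the strict inequality persists. *)
Lemma slab_sum_continuous (R : realType) (m A : nat) (g : nat -> R) (V c v e : R) :
  \sum_(k < A) g k.+1 * (V * Num.sqrt (1 - (k.+1%:R * c) ^+ 2) ^+ m * c) < v -> 0 < e ->
  exists ze, [/\ 0 < ze, ze <= e &
    \sum_(k < A) g k.+1 * (V * Num.sqrt (1 - (k.+1%:R * (c * (1 - ze - ze ^+ 2))) ^+ 2) ^+ m *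
      (c * (1 + 2 * ze))) < v].
Proof.
move=> lt_v e0.
pose f (k : nat) (t : R) := g k.+1 * (V * Num.sqrt (1 - (k.+1%:R * (c *
  (1 - t - t ^+ 2))) ^+ 2) ^+ m * (c * (1 + 2 * t))).
have cf k : f k t @[t --> (0 : R)] --> f k 0.
  have sq (h : R -> R) : h t @[t --> (0 : R)] --> h 0 -> h t ^+ 2 @[t --> (0 : R)] --> h 0 ^+ 2.
    by move=> ch; rewrite expr2; under eq_cvg do rewrite expr2; exact: cvgM.
  have c1 : 1 - t - t ^+ 2 @[t --> (0 : R)] --> (1 - 0 - 0 ^+ 2 : R).
    apply: cvgB; first by apply: cvgB; [exact: cvg_cst|exact: cvg_id].
    by apply: (sq id); exact: cvg_id.
  have c2 : (k.+1%:R * (c * (1 - t - t ^+ 2))) ^+ 2 @[t --> (0 : R)] --> (k.+1%:R * (c *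
    (1 - 0 - 0 ^+ 2))) ^+ 2.
    apply: (sq (fun t => k.+1%:R * (c * (1 - t - t ^+ 2)))).
    by apply: cvgM; [exact: cvg_cst|apply: cvgM; [exact: cvg_cst|exact: c1]].
  have c3 : Num.sqrt (1 - (k.+1%:R * (c * (1 - t - t ^+ 2))) ^+ 2) ^+ m @[t --> (0 : R)] -->
      Num.sqrt (1 - (k.+1%:R * (c * (1 - 0 - 0 ^+ 2))) ^+ 2) ^+ m.
    apply: (@cvg_comp _ _ _ (fun t =>
      Num.sqrt (1 - (k.+1%:R * (c * (1 - t - t ^+ 2))) ^+ 2)) (fun t => t ^+ m));
      last exact: exprn_continuous.
    apply: (@cvg_comp _ _ _ (fun t =>
      (1 - (k.+1%:R * (c * (1 - t - t ^+ 2))) ^+ 2)) (@Num.sqrt R)); last exact: sqrt_continuous.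
    by apply: cvgB; [exact: cvg_cst|exact: c2].
  rewrite /f; apply: cvgM; first exact: cvg_cst.
  apply: cvgM; first by apply: cvgM; [exact: cvg_cst|exact: c3].
  apply: cvgM; first exact: cvg_cst.
  apply: cvgD; first exact: cvg_cst.
  by apply: cvgM; [exact: cvg_cst|exact: cvg_id].
have cF : \sum_(k < A) f k t @[t --> (0 : R)] --> \sum_(k < A) f k 0.
  elim: (A) => [|n IH].
    by rewrite big_ord0; under eq_cvg do rewrite big_ord0; exact: cvg_cst.
  by rewrite big_ord_recr /=; under eq_cvg do rewrite big_ord_recr /=; exact: cvgD.
have F0 : \sum_(k < A) f k 0 < v.
  move: lt_v; congr (_ < _); apply: eq_bigr => k _.
  by rewrite /f expr0n /= !subr0 mulr0 addr0 !mulr1.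
have d0 : 0 < v - \sum_(k < A) f k 0 by rewrite subr_gt0.
move/cvgrPdist_lt : cF => /(_ _ d0) /nbhs_ballP[d /= dd0 Hd].
have ze0 : 0 < Num.min (d / 2) e by rewrite lt_min divr_gt0.
exists (Num.min (d / 2) e); split => //; first by rewrite ge_min lexx orbT.
have := Hd (Num.min (d / 2) e); rewrite /ball /= sub0r normrN ger0_norm ?(ltW ze0) //.
have -> : Num.min (d / 2) e < d by rewrite gt_min ltr_pdivrMr // mulr_natr mulr2n ltrDl dd0.
move=> /(_ isT); rewrite distrC => h.
have := le_lt_trans (ler_norm _) h; rewrite ltrD2r; exact.
Qed.

Theorem theorem4 (R : realType) (n : nat) (hn : (2 <= n)%N)
    (mu : nat -> nat) (hmu0 : (2 <= mu 0)%N)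
    (hmu : forall r, (mu r < mu r.+1)%N)
    (s : nat -> n.-tuple nat) (hs : forall r, mu_sequence (mu r) (s r))
    (Delta : R)
    (hlim : (fun r : nat =>
        (mu r)%:R `^ (n.-1%:R / 2)
          / Num.sqrt (4 ^+ n.-1 * \sum_(i < n) (tnth (s r) i)%:R ^+ 2)
          * ball_volume R n.-1) @ \oo --> Delta)
    (hDelta : 0 < Delta)
    (sigma : R) (hsigma : 0 < sigma)
    (hsum :
      let V := ball_volume R in
      let A := Num.truncn (2 ^- n.-1 * V n.-1 / (V n * Delta * sigma)) in
      2 ^+ n.-1 * Delta *
        (\sum_(1 <= k < A.+1)
           (\sum_(l <- divisors k) (moebius l)%:~R / l%:R ^+ n.-1) *
           (1 - k%:R ^+ 2 * (2 ^+ n.-1 * Delta * (V n / V n.-1) * sigma) ^+ 2)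
             `^ (n.-1%:R / 2)) < 1) :
  exists R0 : nat, forall r : nat, (R0 <= r)%N ->
    exists t : nat,
      [/\ mu_sequence (mu r) (rcons (s r) t), (0 < t)%N &
          t%:R < sigma * (mu r)%:R `^ (n%:R / 2) * ball_volume R n].
Proof.
case: n hn s hs hlim hsum => [//|m] m0 s hs.
change m.+1.-1 with m => hlim hsum.
have V0 := ball_volume_gt0 R m; have Vn0 := ball_volume_gt0 R m.+1.
have [V VE] : exists V, V = ball_volume R m by eexists.
have [Vn VnE] : exists Vn, Vn = ball_volume R m.+1 by eexists.
move: hsum; rewrite /= -VE -VnE => hsum; rewrite -VE in hlim V0; rewrite -VnE in Vn0.
have p20 : 0 < 2 ^+ m :> R by rewrite exprn_gt0.
(* c is the limit of T / (S rho), the height attached to k = 1 at the top T of the window. *)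
have [c cE] : exists c, c = 2 ^+ m * Delta * (Vn / V) * sigma by eexists.
have c0 : 0 < c by rewrite cE !mulr_gt0 ?invr_gt0.
pose g (q : nat) : R := \sum_(l <- divisors q) (moebius l)%:~R / l%:R ^+ m.
have [A AE] : exists A, A = Num.truncn c^-1 by eexists.
have hA : Num.truncn (2 ^- m * V / (Vn * Delta * sigma)) = A.
  rewrite AE cE; congr Num.truncn; field.
  by rewrite !gt_eqF.
have cV : V * c = sigma * Vn * (2 ^+ m * Delta) by rewrite cE; field; rewrite gt_eqF.
have A1 : A%:R * c <= 1.
  by rewrite -ler_pdivlMr // div1r AE truncn_le // invr_ge0 ltW.
have A2 : 1 < A.+1%:R * c.
  by rewrite -ltr_pdivrMr // div1r AE truncnS_gt.
have cA k : (k <= A)%N -> k%:R * c <= 1.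
  by move=> kA; apply: le_trans A1; rewrite ler_pM2r // ler_nat.
have g0 q : (0 < q)%N -> 0 <= g q /\ #|prim_residues m q|%:R = q%:R ^+ m * g q.
  move=> q0; have E := card_prim_residuesE R m q0; split => //.
  have : 0 <= q%:R ^+ m * g q by rewrite -E ler0n.
  by rewrite pmulr_rge0 // exprn_gt0 // ltr0n.
(* This is [hsum] times sigma V_n. As k c <= 1, the base of the real power is nonnegative, and the
   power becomes one of a square root. *)
have E0 : \sum_(k < A) g k.+1 * (V * Num.sqrt (1 - (k.+1%:R * c) ^+ 2) ^+ m * c) < sigma * Vn.
  have : sigma * Vn * (2 ^+ m * Delta * \sum_(k < A) g k.+1 * Num.sqrt (1 - (k.+1%:R *
    c) ^+ 2) ^+ m) < sigma * Vn * 1.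
    rewrite ltr_pM2l ?mulr_gt0 //; move: hsum; rewrite hA; congr (_ * _ < _).
    rewrite big_add1 /= big_mkord; apply: eq_bigr => k _; congr (_ * _).
    rewrite -cE powR_half -?exprMn // subr_ge0 exprn_ile1 ?cA //.
    by rewrite mulr_ge0 // ltW.
  rewrite mulr1; apply: le_lt_trans; rewrite mulrA -cV mulr_sumr le_eqVlt; apply/orP; left;
    apply/eqP.
  by apply: eq_bigr => k _; ring.
(* The second bound keeps (A + 1) al > 1: lowering the height from c to al admits no new k. *)
have eta0 : 0 < Num.min (1 / 4) ((1 - (A.+1%:R * c)^-1) / 4).
  by rewrite lt_min !divr_gt0 // subr_gt0 invf_lt1 // (lt_trans _ A2).
have [ze [ze0]] := slab_sum_continuous E0 eta0.
rewrite le_min => /andP[ze1 ze2]; set EE := \sum_(k < A) _ => HE.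
have ze2' : 1 < A.+1%:R * (c * (1 - ze - ze ^+ 2)).
  have Ac0 : 0 < A.+1%:R * c by exact: lt_trans A2.
  have h1 : ze ^+ 2 <= ze by rewrite expr2 ler_piMr ?(ltW ze0) //; move: ze1; clear; lra.
  have h2 : (A.+1%:R * c)^-1 < 1 by rewrite invf_lt1.
  have h3 : (A.+1%:R * c)^-1 < 1 - ze - ze ^+ 2.
    by move: h1 h2 ze2; set X := (A.+1%:R * c)^-1; clear; lra.
  by rewrite mulrA mulrC -ltr_pdivrMr // div1r.
have zz : ze ^+ 2 <= 1 / 4 * ze by rewrite expr2 ler_pM2r.
have [al alE] : exists al, al = c * (1 - ze - ze ^+ 2) by eexists.
have [be beE] : exists be, be = c * (1 + ze ^+ 2) by eexists.
have al0 : 0 < al by rewrite alE mulr_gt0 //; move: ze0 ze1 zz; clear; lra.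
have albe : al <= be by rewrite alE beE ler_pM2l //; have := sqr_ge0 ze; move: ze0; clear; lra.
have abE : be - al = ze * (c * (1 + 2 * ze)) by rewrite alE beE; ring.
rewrite -alE in ze2'.
pose G := \sum_(k < A) g k.+1.
have G0 : 0 <= G by rewrite sumr_ge0 // => k _; have [] := g0 k.+1 isT.
(* de rho^n is the surplus of the window over the main terms; the counting errors e are to use at
   most a third of it. *)
have [de deE] : exists de, de = ze * (sigma * Vn - EE) by eexists.
have de0 : 0 < de by rewrite deE mulr_gt0 // subr_gt0.
have EE0 : 0 <= EE.
  apply: sumr_ge0 => k _; rewrite !mulr_ge0 ?exprn_ge0 ?sqrtr_ge0 ?(ltW V0) ?(ltW c0) //;
    last by move: ze0; clear; lra.
  by have [] := g0 k.+1 isT.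
pose e := de / (3 * (G + 1)).
have e0 : 0 < e by rewrite divr_gt0 // mulr_gt0 // ltr_wpDl.
have [rho0 Hrho] : exists rho0, forall rho q, rho0 <= rho -> (q < A)%N ->
    forall (f : nat -> nat) (l : seq nat) (z : nat -> 'rV[int]_m.+1),
    let S := Num.sqrt (\sum_(i < m.+1) (f i)%:R ^+ 2) in
    f 0%N = 1%N -> uniq l ->
    (forall t, t \in l -> [/\ \sum_(i < m.+1) (f i)%:Z * z t 0 i = (q.+1 * t)%:Z,
       \sum_i ((z t 0 i)%:~R) ^+ 2 <= rho ^+ 2,
       q.+1%:R * al <= q.+1%:R * t%:R / (S * rho) & q.+1%:R * t%:R / (S * rho) <= q.+1%:R * be]) ->
    (forall t t' i, t \in l -> t' \in l -> (z t 0%R i = z t' 0%R i %[mod q.+1])%Z) ->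
    (size l)%:R <= (rho / q.+1%:R) ^+ m.+1 *
       (V * Num.sqrt (1 - (q.+1%:R * al) ^+ 2) ^+ m * (q.+1%:R * be - q.+1%:R * al) + e).
  apply: uniform_threshold => q qA.
  have q0 : 0 < q.+1%:R :> R by rewrite ltr0n.
  have h1 : 0 < q.+1%:R * al by rewrite mulr_gt0.
  have h2 : q.+1%:R * al <= q.+1%:R * be by rewrite ler_pM2l.
  have h3 : q.+1%:R * be < 2.
    rewrite beE mulrA; have := cA _ qA => h.
    apply: (@le_lt_trans _ _ (1 * (1 + ze ^+ 2))); last by move: zz ze1 ze0; clear; lra.
    by rewrite ler_wpM2r // addr_ge0 // sqr_ge0.
  have [b b0 Hb] := residue_class_count m0 h1 h2 h3 e0.
  exists (b * q.+1%:R) => rho hrho f l z S f0 ul Hl Hc.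
  rewrite VE; exact: (Hb f rho q.+1 l z f0 (ltn0Sn q) hrho ul Hl Hc).
(* An error of second order in ze enters [al] and [be] without spoiling a thickness of first
   order. *)
have hD : 0 < Delta * ze ^+ 2 by rewrite mulr_gt0 // exprn_gt0.
move/cvgrPdist_le : hlim => /(_ _ hD)[r0 _ Hr0].
pose rho1 := Num.max rho0 (6 / de + 1).
exists (maxn r0 (Num.truncn (rho1 ^+ 2)).+1) => r; rewrite geq_max => /andP[rr0 rr1].
have murr : (r <= mu r)%N.
  by elim: (r) => // k IH; exact: leq_ltn_trans (hmu k).
have mu0 : 0 <= (mu r)%:R :> R by [].
have [rho rhoE] : exists rho, rho = Num.sqrt (mu r)%:R :> R by eexists.
have rho2 : rho ^+ 2 = (mu r)%:R by rewrite rhoE sqr_sqrtr.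
have rho10 : 0 < rho1 by rewrite lt_max (_ : 0 < 6 / de + 1) ?orbT // addr_gt0 // divr_gt0.
have rho_ge : rho1 <= rho.
  have rhog : 0 <= rho by rewrite rhoE sqrtr_ge0.
  rewrite -(ler_pXn2r (n:=2)) ?nnegrE ?(ltW rho10) // rho2.
  apply: le_trans (ltW (truncnS_gt _)) _; rewrite ler_nat; exact: leq_trans murr.
have rho_ge0 : rho0 <= rho by apply: le_trans rho_ge; rewrite le_max lexx.
have rho_ge1 : 6 / de + 1 <= rho by apply: le_trans rho_ge; rewrite le_max lexx orbT.
have rhoP : 0 < rho by apply: lt_le_trans rho_ge.
(* The two roundings that produce [n0] and [L] cost at most 2 integers, while at least two thirds of
   the surplus, hence 4, remain. *)
have dr : 6 <= de * rho ^+ m.+1.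
  have h1 : rho <= rho ^+ m.+1.
    have d6 : 0 < 6 / de by rewrite divr_gt0.
    rewrite exprS ler_peMr ?(ltW rhoP) // exprn_ege1 //; move: rho_ge1 d6; set X := 6 / de;
      clear; lra.
  have : 6 / de <= rho ^+ m.+1 by apply: le_trans h1; move: rho_ge1; set X := 6 / de; clear; lra.
  by rewrite ler_pdivrMr // mulrC.
have [T TE] : exists T, T = sigma * rho ^+ m.+1 * Vn by eexists.
rewrite powR_half // -rhoE -TE.
pose f := nth 0%N (s r).
have [f0 fpos flat] := hs r; rewrite -/f in f0.
have szs : size (s r) = m.+1 by rewrite size_tuple.
pose S : R := Num.sqrt (\sum_(i < m.+1) (f i)%:R ^+ 2).
have S2 : 1 <= \sum_(i < m.+1) (f i)%:R ^+ 2 :> R.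
  rewrite big_ord_recl /= f0 expr1n lerDl sumr_ge0 // => i _; exact: sqr_ge0.
have S0 : 0 < S by rewrite sqrtr_gt0 (lt_le_trans _ S2).
have Ssq : S ^+ 2 = \sum_(i < m.+1) (f i)%:R ^+ 2 by rewrite sqr_sqrtr // (le_trans _ S2).
have cr : c * (1 - ze ^+ 2) <= T / (S * rho) /\ T / (S * rho) <= c * (1 + ze ^+ 2).
  have := Hr0 r rr0; rewrite /= powR_half // -rhoE.
  have -> : \sum_(i < m.+1) (tnth (s r) i)%:R ^+ 2 = S ^+ 2.
    by rewrite Ssq; apply: eq_bigr => i _; rewrite (tnth_nth 0%N).
  have -> : Num.sqrt (4 ^+ m * S ^+ 2) = 2 ^+ m * S.
    rewrite (_ : 4 = 2 ^+ 2); last by rewrite -natrX.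
    by rewrite -exprM mulnC exprM -exprMn sqrtr_sqr ger0_norm // mulr_ge0 // ltW.
  have [D DE] : exists D, D = rho ^+ m / (2 ^+ m * S) * V by eexists.
  rewrite -DE.
  have -> : T / (S * rho) = (2 ^+ m * (Vn / V) * sigma) * D.
    by rewrite TE DE exprS; field; rewrite !gt_eqF.
  have -> : c = (2 ^+ m * (Vn / V) * sigma) * Delta by rewrite cE; ring.
  have k0 : 0 < 2 ^+ m * (Vn / V) * sigma by rewrite !mulr_gt0 ?invr_gt0.
  rewrite -!mulrA !ler_pM2l ?invr_gt0 // ler_norml => /andP[h1 h2].
  have h3 : D <= Delta * (1 + ze ^+ 2) by move: h1 h2; clear; lra.
  have h4 : Delta * (1 - ze ^+ 2) <= D by move: h1 h2; clear; lra.
  by split.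
apply: contrapT => Hno.
have T0 : 0 < T by rewrite TE !mulr_gt0 ?exprn_gt0.
have zT : 6 <= ze * T.
  apply: le_trans dr _; rewrite TE deE.
  have -> : ze * (sigma * rho ^+ m.+1 * Vn) = ze * (sigma * Vn) * rho ^+ m.+1 by ring.
  by rewrite ler_pM2r ?exprn_gt0 // ler_pM2l // gerBl.
(* The successor makes n0 positive and at least (1 - ze) T; the L integers from n0 on stay strictly
   below T. *)
pose n0 := (Num.truncn ((1 - ze) * T)).+1.
have ze1T : 0 <= (1 - ze) * T by rewrite mulr_ge0 ?(ltW T0) //; move: ze1; clear; lra.
have n0g : (1 - ze) * T <= n0%:R by rewrite ltW // truncnS_gt.
have n0l : n0%:R <= (1 - ze) * T + 1 by rewrite /n0 -natr1 lerD2r truncn_le.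
pose L := Num.truncn (T - n0%:R).
have L1 : L%:R <= T - n0%:R by rewrite truncn_le //; move: n0l zT; clear; lra.
have L2 : T - n0%:R < L%:R + 1 by rewrite natr1 truncnS_gt.
pose ts := iota n0 L.
have tsP t : t \in ts -> [/\ (0 < t)%N, (1 - ze) * T <= t%:R & t%:R < T].
  rewrite mem_iota => /andP[t1 t2]; split; first by apply: leq_trans t1.
    by apply: le_trans n0g _; rewrite ler_nat.
  have : t.+1%:R <= (n0 + L)%N%:R :> R by rewrite ler_nat.
  by rewrite natrD -natr1; move: L1; clear; lra.
(* Membership in [ts] sits under the existential, with a dummy pair elsewhere, so that [choice]
   yields functions on all of nat. *)
have wit t : exists zk : 'rV[int]_m.+1 * nat, t \in ts ->
    [/\ (0 < zk.2)%N, \sum_(i < m.+1) (f i)%:Z * zk.1 0 i = (zk.2 * t)%:Z,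
    sqnorm zk.1 + zk.2%:Z ^+ 2 < (mu r)%:Z &
    forall d, (1 < d)%N -> (d %| zk.2)%N -> ~ forall i, (d%:Z %| zk.1 0%R i)%Z].
  have [tts|_] := boolP (t \in ts); last by exists (0, 0%N).
  have [t0 _ tT] := tsP t tts.
  have [|z [k H]] := @nonextension_witness m (mu r) (s r) t szs m0 (hs r) t0.
    by move=> H; apply: Hno; exists t; split.
  by exists (z, k).
have {wit} [zk Hzk] := choice wit.
pose z t := (zk t).1; pose k t := (zk t).2.
have normz t : t \in ts -> \sum_i ((z t 0 i)%:~R) ^+ 2 <= rho ^+ 2.
  move=> tts; have [k0 _ N _] := Hzk t tts.
  have : sqnorm (z t) <= (mu r)%:Z.
    by apply: le_trans (ltW N); rewrite lerDl sqr_ge0.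
  rewrite -(ler_int R) rho2 rmorph_sum /=; congr (_ <= _).
  by apply: eq_bigr => i _; rewrite rmorphXn.
have tb t : t \in ts -> al <= t%:R / (S * rho) /\ t%:R / (S * rho) <= be.
  move=> tts; have [_ t1 t2] := tsP t tts; have [cr1 cr2] := cr.
  have Srho : 0 < (S * rho)^-1 by rewrite invr_gt0 mulr_gt0.
  split; last by rewrite beE; apply: le_trans cr2; rewrite ler_pM2r // ltW.
  apply: (@le_trans _ _ ((1 - ze) * T / (S * rho))); last by rewrite ler_pM2r.
  (* [al] is c (1 - ze) (1 - ze^2) without its positive cubic term. *)
  rewrite -mulrA alE; apply: (@le_trans _ _ ((1 - ze) * (c * (1 - ze ^+ 2)))); last first.
    by rewrite ler_wpM2l //; move: ze1; clear; lra.
  have -> : (1 - ze) * (c * (1 - ze ^+ 2)) = c * (1 - ze - ze ^+ 2 + ze ^+ 3) by ring.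
  by rewrite ler_pM2l // lerDl exprn_ge0 // ltW.
(* By Cauchy-Schwarz the height u.z / rho of a point of the unit ball is at most 1; with heights at
   least k [al] this bounds k by A. *)
have ky t : t \in ts -> (k t)%:R * (t%:R / (S * rho)) <= 1.
  move=> tts; have [k0 E N _] := Hzk t tts.
  pose u (i : 'I_m.+1) := (f i)%:R / S : R.
  have u1 : \sum_i u i ^+ 2 = 1.
    under eq_bigr do rewrite /u expr_div_n.
    by rewrite -mulr_suml -Ssq divff // gt_eqF // exprn_gt0.
  have := bessel_unit (fun i => (z t 0 i)%:~R) u1 => /le_trans/(_ (normz t tts)).
  have -> : \sum_i u i * (z t 0 i)%:~R = (k t)%:R * t%:R / S.
    rewrite -natrM -[(k t * t)%N%:R]/(((k t * t)%N%:Z)%:~R) -E rmorph_sum /= mulr_suml.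
    by apply: eq_bigr => i _; rewrite intrM /u mulrAC.
  rewrite ler_pXn2r ?nnegrE ?(ltW rhoP) ?mulr_ge0 ?invr_ge0 ?(ltW S0) // => h.
  by rewrite invfM !mulrA ler_pdivrMr // mul1r.
have kA t : t \in ts -> (k t <= A)%N.
  move=> tts; rewrite leqNgt; apply/negP => Ak.
  have [h1 _] := tb t tts; have := ky t tts; rewrite leNgt => /negP; apply.
  apply: (lt_le_trans ze2'); rewrite ler_pM //; first by rewrite ltW.
  by rewrite ler_nat.
pose N (q : nat) := (rho / q%:R) ^+ m.+1 *
   (V * Num.sqrt (1 - (q%:R * al) ^+ 2) ^+ m * (q%:R * be - q%:R * al) + e).
have := @count_witnesses R m A f ts z k N f0 (iota_uniq _ _).
have c1 t : t \in ts -> [/\ (0 < k t)%N, (k t <= A)%N,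
     \sum_(i < m.+1) (f i)%:Z * z t 0 i = (k t * t)%:Z &
     forall d, (1 < d)%N -> (d %| k t)%N -> ~ forall i, (d%:Z %| z t 0%R i)%Z].
  by move=> tts; have [h1 h2 h3 h4] := Hzk t tts; split => //; exact: kA.
move=> /(_ c1) HC.
have {HC} : (size ts)%:R <= \sum_(q < A) #|prim_residues m q.+1|%:R * N q.+1.
  apply: HC => -[//|q] qA l ul lts lk lc.
  have {}qA : (q < A)%N by case/andP: qA.
  apply: (Hrho rho q rho_ge0 qA f l z f0 ul _ lc) => t tl; have tts := lts t tl.
  have [h1 h2 h3 h4] := Hzk t tts; have [b1 b2] := tb t tts.
  have kq : (zk t).2 = q.+1 by exact: lk.
  split.
  - by rewrite -kq.
  - exact: normz.
  - by rewrite -mulrA ler_pM2l // ltr0n.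
  - by rewrite -mulrA ler_pM2l // ltr0n.
rewrite size_iota.
have : \sum_(q < A) #|prim_residues m q.+1|%:R * N q.+1 <= rho ^+ m.+1 * (ze * EE + e * G).
  rewrite /EE /G !mulr_sumr -big_split /= mulr_sumr; apply: ler_sum => q _.
  have [gq ->] := g0 q.+1 isT; rewrite /N.
  have q0 : 0 < q.+1%:R :> R by rewrite ltr0n.
  (* The powers of k cancel: k^m g(k) classes, (rho / k)^(m+1) points per unit volume, thickness k
     (be - al). Only the error term keeps a factor 1/k. *)
  have -> : q.+1%:R ^+ m * g q.+1 * ((rho / q.+1%:R) ^+ m.+1 *
     (V * Num.sqrt (1 - (q.+1%:R * al) ^+ 2) ^+ m * (q.+1%:R * be - q.+1%:R * al) + e)) =
     rho ^+ m.+1 * (g q.+1 * (V * Num.sqrt (1 - (q.+1%:R * al) ^+ 2) ^+ m * (be - al)) +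
       g q.+1 * e / q.+1%:R).
    rewrite expr_div_n (exprS q.+1%:R); field.
    by rewrite !gt_eqF // exprn_gt0.
  rewrite ler_pM2l ?exprn_gt0 //; apply: lerD.
    by rewrite abE -alE le_eqVlt; apply/orP; left; apply/eqP; ring.
  by rewrite ler_pdivrMr // [X in X <= _]mulrC ler_peMr ?ler1n // mulr_ge0 // ltW.
have eG : e * G <= de / 3.
  rewrite /e; have -> : de / (3 * (G + 1)) * G = de / 3 * (G / (G + 1)).
    by field; rewrite gt_eqF // ltr_wpDl.
  rewrite ler_piMr // ?divr_ge0 ?(ltW de0) // ler_pdivrMr ?ltr_wpDl // mul1r lerDl //.
move=> h1 h2.
have h3 : rho ^+ m.+1 * (ze * EE + e * G) <= rho ^+ m.+1 * (ze * EE + de / 3).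
  by rewrite ler_pM2l ?exprn_gt0 // lerD2l.
have h4 : ze * T = rho ^+ m.+1 * (ze * EE + de) by rewrite TE deE; ring.
have := le_trans h2 (le_trans h1 h3).
move: h4 L2 n0l dr; set P := rho ^+ m.+1; set LL := L%:R; set nn := n0%:R.
by clear; lra.
Qed.
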